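(* Let $A$ be a commutative ring with unit, let $B$ be a commutative $A$-algebra, and let $I,J\subseteq B$ be ideals such that $B/I$, $B/J$, $B/(I\cap J)$ and $B/(I+J)$ are finite locally free over $A$. Then for every $b\in B$ the following formula holds: $$\det(\mu_b^I)\det(\mu_b^J)=\det(\mu_b^{I\cap J})\det(\mu_b^{I+J}).$$ Consequently, $$U_I(b)\cap U_J(b)=U_{I\cap J}(b)\cap U_{I+J}(b).$$
   Context: For an ideal $L$ of $B$ such that $B/L$ is finite locally free over $A$ (finitely generated and locally free of finite, possibly non-constant, rank as an $A$-module) and $b\in B$, the map $\mu_b^L\colon B/L\to B/L$, $x+L\mapsto bx+L$, is regarded as an $A$-linear endomorphism, and $\det(\mu_b^L)\in A$ is its determinant (defined locally on $\operatorname{Spec}(A)$ by choosing bases; the determinant of the endomorphism of the zero module is $1$). For a commutative ring $R$ and an ideal $N$ of $R$, $S_N:=\{r\in R\mid \text{multiplication by } r \text{ on } R/N \text{ is injective}\}$. The fiberwise regular-denominator locus is $$U_L(b):=\{P\in\operatorname{Spec}(A)\mid b\otimes 1\in S_{L(B\otimes_A(A_P/PA_P))}\},$$ where $A_P/PA_P$ is the residue field at $P$, $b\otimes 1$ is the image of $b$ in the fiber ring $B\otimes_A(A_P/PA_P)$, and $L(B\otimes_A(A_P/PA_P))$ is the ideal of this ring generated by the image of $L$. *)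

(* Defs.v *)
From HB Require Import structures.
From mathcomp Require Import all_boot all_order all_algebra ring.
From mathcomp Require Import boolp classical_sets.

Set Implicit Arguments.
Unset Strict Implicit.
Unset Printing Implicit Defensive.

Import GRing.Theory.

Local Open Scope classical_set_scope.
Local Open Scope ring_scope.
Local Open Scope quotient_scope.

(* The library's algebra structures exclude the zero ring.  Quotients of an
   algebra, localizations and fiber rings may all be zero, so a commutative
   algebra is a possibly trivial commutative ring with a structure map. *)
HB.mixin Record isComPzAlgebra (A : comPzRingType) (B : Type)
    of GRing.ComPzRing B := {
  alg_map : {rmorphism A -> B}
}.

#[short(type="comPzAlgType")]
HB.structure Definition ComPzAlgebra (A : comPzRingType) :=
  {B of isComPzAlgebra A B & GRing.ComPzRing B}.

Definition as_module (A : comPzRingType) (B : comPzAlgType A) : Type := B.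

Section AsModule.
Variables (A : comPzRingType) (B : comPzAlgType A).

HB.instance Definition _ := GRing.Zmodule.on (as_module B).

Definition alg_scale (a : A) (x : as_module B) : as_module B :=
  (alg_map a : B) * (x : B).

Lemma alg_scaleA a b x : alg_scale a (alg_scale b x) = alg_scale (a * b) x.
Proof. by rewrite /alg_scale rmorphM mulrA. Qed.

Lemma alg_scale1 : left_id 1 alg_scale.
Proof. by move=> x; rewrite /alg_scale rmorph1 mul1r. Qed.

Lemma alg_scaleDr : right_distributive alg_scale +%R.
Proof. by move=> a x y; apply: mulrDr. Qed.

Lemma alg_scaleDl x : {morph alg_scale^~ x : a b / a + b}.
Proof. by move=> a b; rewrite /alg_scale rmorphD mulrDl. Qed.

HB.instance Definition _ := GRing.Zmodule_isLmodule.Build A (as_module B)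
  alg_scaleA alg_scale1 alg_scaleDr alg_scaleDl.

Lemma alg_scaleE (a : A) (x : as_module B) :
  a *: x = (alg_map a : B) * (x : B).
Proof. by []. Qed.

End AsModule.

Record ideal (R : comPzRingType) := Ideal {
  ideal_set :> set R;
  ideal0 : ideal_set 0;
  idealD : forall x y, ideal_set x -> ideal_set y -> ideal_set (x + y);
  idealMl : forall a x, ideal_set x -> ideal_set (a * x)
}.

Section IdealOps.
Variable R : comPzRingType.
Implicit Types I J : ideal R.

Lemma idealN I x : ideal_set I x -> ideal_set I (- x).
Proof. by move=> Ix; rewrite -mulN1r; apply: idealMl. Qed.

Lemma idealB I x y : ideal_set I x -> ideal_set I y -> ideal_set I (x - y).
Proof. by move=> Ix Iy; apply: idealD => //; apply: idealN. Qed.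

Definition ideal_cap I J : ideal R.
Proof.
refine (@Ideal R (I `&` J) _ _ _).
- by split; apply: ideal0.
- by move=> x y [Ix Jx] [Iy Jy]; split; apply: idealD.
- by move=> a x [Ix Jx]; split; apply: idealMl.
Defined.

Definition ideal_add I J : ideal R.
Proof.
refine (@Ideal R [set z | exists x y, [/\ ideal_set I x, ideal_set J y
                                        & z = x + y]] _ _ _).
- by exists 0, 0; rewrite addr0; split=> //; apply: ideal0.
- move=> _ _ [x [y [Ix Jy ->]]] [x' [y' [Ix' Jy' ->]]].
  by exists (x + x'), (y + y'); rewrite addrACA; split=> //; apply: idealD.
- move=> a _ [x [y [Ix Jy ->]]].
  by exists (a * x), (a * y); rewrite mulrDr; split=> //; apply: idealMl.
Defined.

Definition ideal_gen (X : set R) : ideal R.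
Proof.
refine (@Ideal R [set x | forall I, X `<=` I -> ideal_set I x] _ _ _).
- by move=> I _; apply: ideal0.
- by move=> x y hx hy I XI; apply: idealD; [apply: hx|apply: hy].
- by move=> a x hx I XI; apply: idealMl; apply: hx.
Defined.

Definition prime_ideal I : Prop :=
  ~ ideal_set I 1 /\
  forall x y, ideal_set I (x * y) -> ideal_set I x \/ ideal_set I y.

End IdealOps.

Record spec (A : comPzRingType) := Spec {
  spec_ideal :> ideal A;
  spec_prime : prime_ideal spec_ideal
}.

Section QuotientRing.
Variables (R : comPzRingType) (L : ideal R).

Definition ideal_eqv (x y : R) : bool := `[< ideal_set L (x - y) >].

Lemma ideal_eqv_refl : reflexive ideal_eqv.
Proof. by move=> x; apply/asboolP; rewrite subrr; apply: ideal0. Qed.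

Lemma ideal_eqv_sym : symmetric ideal_eqv.
Proof.
by move=> x y; apply/asboolP/asboolP => h; rewrite -opprB; apply: idealN.
Qed.

Lemma ideal_eqv_trans : transitive ideal_eqv.
Proof.
move=> y x z /asboolP xy /asboolP yz; apply/asboolP.
by rewrite -(subrK y x) -addrA; apply: idealD.
Qed.

Canonical ideal_eqv_equiv :=
  EquivRel ideal_eqv ideal_eqv_refl ideal_eqv_sym ideal_eqv_trans.

Definition qring := {eq_quot ideal_eqv}.
HB.instance Definition _ : EqQuotient _ ideal_eqv qring := EqQuotient.on qring.
HB.instance Definition _ := Choice.on qring.

Definition qcls (x : R) : qring := \pi x.

Lemma qclsP x y : qcls x = qcls y <-> ideal_set L (x - y).
Proof. by split=> [/eqmodP/asboolP|h] //; apply/eqmodP/asboolP. Qed.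

Lemma qring_ind (P : qring -> Prop) : (forall x, P (qcls x)) -> forall u, P u.
Proof. exact: quotW. Qed.

Lemma qcls_repr u : qcls (repr u) = u.
Proof. exact: reprK. Qed.

Lemma repr_qcls x : ideal_set L (repr (qcls x) - x).
Proof. by apply/qclsP; rewrite qcls_repr. Qed.

Definition qadd (u v : qring) := qcls (repr u + repr v).
Definition qopp (u : qring) := qcls (- repr u).
Definition qmul (u v : qring) := qcls (repr u * repr v).

Lemma qaddE x y : qadd (qcls x) (qcls y) = qcls (x + y).
Proof.
by apply/qclsP; rewrite opprD addrACA; apply: idealD; apply: repr_qcls.
Qed.

Lemma qoppE x : qopp (qcls x) = qcls (- x).
Proof. by apply/qclsP; rewrite -opprD; apply/idealN/repr_qcls. Qed.

Lemma qmulE x y : qmul (qcls x) (qcls y) = qcls (x * y).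
Proof.
apply/qclsP; rewrite -(subrK (x * repr (qcls y)) (_ * repr _)) -addrA.
rewrite -mulrBl -mulrBr mulrC.
by apply: idealD; apply/idealMl/repr_qcls.
Qed.

Lemma qaddA : associative qadd.
Proof.
by elim/qring_ind=> x; elim/qring_ind=> y; elim/qring_ind=> z;
  rewrite !qaddE addrA.
Qed.

Lemma qaddC : commutative qadd.
Proof. by elim/qring_ind=> x; elim/qring_ind=> y; rewrite !qaddE addrC. Qed.

Lemma qadd0 : left_id (qcls 0) qadd.
Proof. by elim/qring_ind=> x; rewrite qaddE add0r. Qed.

Lemma qaddN : left_inverse (qcls 0) qopp qadd.
Proof. by elim/qring_ind=> x; rewrite qoppE qaddE addNr. Qed.

HB.instance Definition _ :=
  GRing.isZmodule.Build qring qaddA qaddC qadd0 qaddN.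

Lemma qmulA : associative qmul.
Proof.
by elim/qring_ind=> x; elim/qring_ind=> y; elim/qring_ind=> z;
  rewrite !qmulE mulrA.
Qed.

Lemma qmulC : commutative qmul.
Proof. by elim/qring_ind=> x; elim/qring_ind=> y; rewrite !qmulE mulrC. Qed.

Lemma qmul1 : left_id (qcls 1) qmul.
Proof. by elim/qring_ind=> x; rewrite qmulE mul1r. Qed.

Lemma qmulDl : left_distributive qmul +%R.
Proof.
elim/qring_ind=> x; elim/qring_ind=> y; elim/qring_ind=> z.
by rewrite /GRing.add /= !(qmulE, qaddE) mulrDl.
Qed.

HB.instance Definition _ :=
  GRing.Zmodule_isComPzRing.Build qring qmulA qmulC qmul1 qmulDl.

Lemma qclsB : zmod_morphism qcls.
Proof. by move=> x y; rewrite /GRing.add /GRing.opp /= qoppE qaddE. Qed.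

Lemma qclsM : monoid_morphism qcls.
Proof. by split=> // x y; rewrite /GRing.mul /= qmulE. Qed.

HB.instance Definition _ := GRing.isZmodMorphism.Build R qring qcls qclsB.
HB.instance Definition _ := GRing.isMonoidMorphism.Build R qring qcls qclsM.

End QuotientRing.

HB.instance Definition _ (A : comPzRingType) (B : comPzAlgType A)
    (L : ideal B) :=
  isComPzAlgebra.Build A (qring L) (qcls L \o @alg_map A B).

Definition regular_mod (R : comPzRingType) (N : ideal R) : set R :=
  [set r | injective (fun u : qring N => qcls N r * u)].

Record mulset (A : comPzRingType) := Mulset {
  mulset_set :> set A;
  mulset1 : mulset_set 1;
  mulsetM : forall s t, mulset_set s -> mulset_set t -> mulset_set (s * t)
}.

Definition powers (A : comPzRingType) (f : A) : mulset A.
Proof.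
refine (@Mulset A [set s | exists n, s = f ^+ n] _ _).
- by exists 0%N.
- by move=> _ _ [m ->] [n ->]; exists (m + n)%N; rewrite exprD.
Defined.

Definition prime_compl (A : comPzRingType) (P : spec A) : mulset A.
Proof.
refine (@Mulset A (~` P) _ _).
- exact: (spec_prime P).1.
- by move=> s t Ps Pt /(spec_prime P).2[].
Defined.

Section Localization.
Variables (A : comPzRingType) (S : mulset A).

Definition den (s : S) : A := val s.
Arguments den : simpl never.

Definition ms_one : S := SigSub (mem_set (mulset1 S)).
Definition ms_mul (s t : S) : S :=
  SigSub (mem_set (mulsetM (set_mem (valP s)) (set_mem (valP t)))).

Lemma ms_mulE s t : den (ms_mul s t) = den s * den t.
Proof. by []. Qed.

Section Module.
Variable M : lmodType A.

Definition loc_eqv (x y : M * S) : bool :=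
  `[< exists u : S, den u *: (den y.2 *: x.1) = den u *: (den x.2 *: y.1) >].

Lemma loc_eqv_refl : reflexive loc_eqv.
Proof. by move=> x; apply/asboolP; exists ms_one. Qed.

Lemma loc_eqv_sym : symmetric loc_eqv.
Proof. by move=> x y; apply/asboolP/asboolP => -[u h]; exists u. Qed.

Lemma loc_eqv_trans : transitive loc_eqv.
Proof.
move=> [m2 s2] [m1 s1] [m3 s3] /asboolP[u /= hu] /asboolP[v /= hv].
apply/asboolP; exists (ms_mul s2 (ms_mul u v)); rewrite !ms_mulE /=.
transitivity ((den s3 * den v) *: (den u *: (den s2 *: m1))).
  by rewrite !scalerA; congr (_ *: _); ring.
rewrite hu.
transitivity ((den s1 * den u) *: (den v *: (den s3 *: m2))).
  by rewrite !scalerA; congr (_ *: _); ring.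
by rewrite hv !scalerA; congr (_ *: _); ring.
Qed.

Canonical loc_eqv_equiv :=
  EquivRel loc_eqv loc_eqv_refl loc_eqv_sym loc_eqv_trans.

Definition loc := {eq_quot loc_eqv}.
HB.instance Definition _ : EqQuotient _ loc_eqv loc := EqQuotient.on loc.
HB.instance Definition _ := Choice.on loc.

Definition frac (m : M) (s : S) : loc := \pi_loc (m, s).

Lemma fracP m s n t : frac m s = frac n t <->
  exists u : S, den u *: (den t *: m) = den u *: (den s *: n).
Proof. by split=> [/eqmodP/asboolP|h] //; apply/eqmodP/asboolP. Qed.

Lemma loc_ind (P : loc -> Prop) :
  (forall m s, P (frac m s)) -> forall x, P x.
Proof. by move=> h; apply: quotW => -[m s]; apply: h. Qed.

Lemma frac_repr x : frac (repr x).1 (repr x).2 = x.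
Proof. by rewrite /frac -surjective_pairing reprK. Qed.

Lemma repr_frac m s : exists u : S,
  den u *: (den s *: (repr (frac m s)).1)
  = den u *: (den (repr (frac m s)).2 *: m).
Proof. by apply/fracP; rewrite frac_repr. Qed.

Lemma eq_frac m s n t : den t *: m = den s *: n -> frac m s = frac n t.
Proof. by move=> h; apply/fracP; exists ms_one; rewrite h. Qed.

Definition loc_add (x y : loc) : loc :=
  frac (den (repr y).2 *: (repr x).1 + den (repr x).2 *: (repr y).1)
       (ms_mul (repr x).2 (repr y).2).
Definition loc_opp (x : loc) : loc := frac (- (repr x).1) (repr x).2.

Lemma loc_addE m s n t : loc_add (frac m s) (frac n t) =
  frac (den t *: m + den s *: n) (ms_mul s t).
Proof.
apply/fracP.
case: (repr_frac m s) (repr_frac n t).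
move: (repr (frac m s)) (repr (frac n t)) => [m' s'] [n' t'] u /= hu [v hv].
exists (ms_mul u v); rewrite !ms_mulE !scalerDr; congr (_ + _).
  transitivity ((den v * den t * den t') *: (den u *: (den s *: m'))).
    by rewrite !scalerA; congr (_ *: _); ring.
  by rewrite hu !scalerA; congr (_ *: _); ring.
transitivity ((den u * den s * den s') *: (den v *: (den t *: n'))).
  by rewrite !scalerA; congr (_ *: _); ring.
by rewrite hv !scalerA; congr (_ *: _); ring.
Qed.

Lemma loc_oppE m s : loc_opp (frac m s) = frac (- m) s.
Proof.
apply/fracP; case: (repr_frac m s) => u hu; exists u.
by rewrite !scalerN hu.
Qed.

Lemma loc_addA : associative loc_add.
Proof.
elim/loc_ind=> m s; elim/loc_ind=> n t; elim/loc_ind=> p r.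
rewrite !loc_addE; apply: eq_frac; rewrite !ms_mulE !scalerDr !scalerA.
by rewrite addrA; do 2?congr (_ + _); congr (_ *: _); ring.
Qed.

Lemma loc_addC : commutative loc_add.
Proof.
elim/loc_ind=> m s; elim/loc_ind=> n t; rewrite !loc_addE.
by apply: eq_frac; rewrite !ms_mulE mulrC addrC.
Qed.

Lemma loc_add0 : left_id (frac 0 ms_one) loc_add.
Proof.
elim/loc_ind=> m s; rewrite loc_addE; apply: eq_frac.
by rewrite !ms_mulE scaler0 add0r !scalerA; congr (_ *: _); ring.
Qed.

Lemma loc_addN : left_inverse (frac 0 ms_one) loc_opp loc_add.
Proof.
elim/loc_ind=> m s; rewrite loc_oppE loc_addE; apply: eq_frac.
by rewrite scalerN addNr !scaler0.
Qed.

HB.instance Definition _ :=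
  GRing.isZmodule.Build loc loc_addA loc_addC loc_add0 loc_addN.

Lemma fracD m s n t :
  frac m s + frac n t = frac (den t *: m + den s *: n) (ms_mul s t).
Proof. exact: loc_addE. Qed.

Lemma fracN m s : - frac m s = frac (- m) s.
Proof. exact: loc_oppE. Qed.

End Module.

Definition loc_ring := loc A^o.
HB.instance Definition _ := GRing.Zmodule.on loc_ring.

Definition rfrac (a : A) (s : S) : loc_ring := frac (a : A^o) s.

Lemma loc_ring_ind (P : loc_ring -> Prop) :
  (forall a s, P (rfrac a s)) -> forall x, P x.
Proof. exact: (@loc_ind A^o P). Qed.

Lemma rfracP a s b t : rfrac a s = rfrac b t <->
  exists u : S, den u * (den t * a) = den u * (den s * b).
Proof. exact: (@fracP A^o a s b t). Qed.

Lemma eq_rfrac a s b t : den t * a = den s * b -> rfrac a s = rfrac b t.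
Proof. exact: (@eq_frac A^o a s b t). Qed.

Lemma rfracD a s b t :
  rfrac a s + rfrac b t = rfrac (den t * a + den s * b) (ms_mul s t).
Proof. exact: (@fracD A^o a s b t). Qed.

Definition loc_scale (M : lmodType A) (x : loc_ring) (y : loc M) : loc M :=
  frac (((repr x).1 : A) *: (repr y).1) (ms_mul (repr x).2 (repr y).2).

Lemma loc_scaleE (M : lmodType A) a s (m : M) t :
  loc_scale (rfrac a s) (frac m t) = frac (a *: m) (ms_mul s t).
Proof.
apply/fracP; case: (@repr_frac A^o a s) (repr_frac m t).
rewrite -/(rfrac a s).
move: (repr (rfrac a s)) (repr (frac m t)) => [a' s'] [m' t'] u /= hu [v hv].
rewrite /GRing.scale /= in hu.
exists (ms_mul u v); rewrite !ms_mulE.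
transitivity ((den u * (den s * a')) *: (den v *: (den t *: m'))).
  by rewrite !scalerA; congr (_ *: _); ring.
by rewrite hu hv !scalerA; congr (_ *: _); ring.
Qed.

Definition loc_mul (x y : loc_ring) : loc_ring := @loc_scale A^o x y.

Lemma loc_mulE a s b t :
  loc_mul (rfrac a s) (rfrac b t) = rfrac (a * b) (ms_mul s t).
Proof. exact: (@loc_scaleE A^o a s b t). Qed.

Lemma loc_mulA : associative loc_mul.
Proof.
elim/loc_ring_ind=> a s; elim/loc_ring_ind=> b t; elim/loc_ring_ind=> c r.
by rewrite !loc_mulE; apply: eq_rfrac; rewrite !ms_mulE; ring.
Qed.

Lemma loc_mulC : commutative loc_mul.
Proof.
elim/loc_ring_ind=> a s; elim/loc_ring_ind=> b t.
by rewrite !loc_mulE; apply: eq_rfrac; rewrite !ms_mulE; ring.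
Qed.

Lemma loc_mul1 : left_id (rfrac 1 ms_one) loc_mul.
Proof.
elim/loc_ring_ind=> a s; rewrite !loc_mulE.
by apply: eq_rfrac; rewrite !ms_mulE mul1r [den ms_one]/= mul1r.
Qed.

Lemma loc_mulDl : left_distributive loc_mul +%R.
Proof.
elim/loc_ring_ind=> a s; elim/loc_ring_ind=> b t; elim/loc_ring_ind=> c r.
rewrite rfracD !loc_mulE rfracD.
by apply: eq_rfrac; rewrite !ms_mulE; ring.
Qed.

HB.instance Definition _ := GRing.Zmodule_isComPzRing.Build loc_ring
  loc_mulA loc_mulC loc_mul1 loc_mulDl.

Lemma rfracM a s b t : rfrac a s * rfrac b t = rfrac (a * b) (ms_mul s t).
Proof. exact: loc_mulE. Qed.

Definition loc_map (a : A) : loc_ring := rfrac a ms_one.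

Lemma loc_map_zmod : zmod_morphism loc_map.
Proof.
move=> a b; rewrite /loc_map /rfrac fracN -/(rfrac _ _) -/(rfrac _ _) rfracD.
by apply: eq_rfrac; rewrite !ms_mulE [den ms_one]/= !mul1r.
Qed.

Lemma loc_map_monoid : monoid_morphism loc_map.
Proof.
split=> // a b; rewrite /loc_map rfracM.
by apply: eq_rfrac; rewrite !ms_mulE [den ms_one]/= !mul1r.
Qed.

HB.instance Definition _ :=
  GRing.isZmodMorphism.Build A loc_ring loc_map loc_map_zmod.
HB.instance Definition _ :=
  GRing.isMonoidMorphism.Build A loc_ring loc_map loc_map_monoid.
HB.instance Definition _ := isComPzAlgebra.Build A loc_ring loc_map.

Section LocModule.
Variable M : lmodType A.

Lemma loc_scaleA x y (z : loc M) :
  loc_scale x (loc_scale y z) = loc_scale (x * y) z.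
Proof.
elim/loc_ring_ind: x => a s; elim/loc_ring_ind: y => b t.
elim/loc_ind: z => m r; rewrite rfracM !loc_scaleE scalerA.
by apply: eq_frac; rewrite !ms_mulE mulrA.
Qed.

Lemma loc_scale1 : left_id 1 (@loc_scale M).
Proof.
elim/loc_ind=> m s; rewrite loc_scaleE scale1r.
by apply: eq_frac; rewrite !ms_mulE [den ms_one]/= mul1r.
Qed.

Lemma loc_scaleDr : right_distributive (@loc_scale M) +%R.
Proof.
elim/loc_ring_ind=> a s; elim/loc_ind=> m t; elim/loc_ind=> n r.
rewrite fracD !loc_scaleE fracD; apply: eq_frac.
rewrite !ms_mulE !scalerDr !scalerA.
by congr (_ + _); congr (_ *: _); ring.
Qed.

Lemma loc_scaleDl (z : loc M) : {morph (@loc_scale M)^~ z : x y / x + y}.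
Proof.
elim/loc_ind: z => m r.
elim/loc_ring_ind=> a s; elim/loc_ring_ind=> b t.
rewrite rfracD !loc_scaleE fracD; apply: eq_frac.
rewrite !ms_mulE !scalerA -scalerDl scalerA; congr (_ *: _); ring.
Qed.

HB.instance Definition _ := GRing.Zmodule_isLmodule.Build loc_ring (loc M)
  loc_scaleA loc_scale1 loc_scaleDr loc_scaleDl.

Lemma fracZ a s (m : M) t :
  rfrac a s *: frac m t = frac (a *: m) (ms_mul s t).
Proof. exact: loc_scaleE. Qed.

Definition loc_fun (phi : {linear M -> M}) (x : loc M) : loc M :=
  frac (phi (repr x).1) (repr x).2.

Lemma loc_funE (phi : {linear M -> M}) m s :
  loc_fun phi (frac m s) = frac (phi m) s.
Proof.
apply/fracP; case: (repr_frac m s) => u hu; exists u.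
by have /= := congr1 phi hu; rewrite !(linearZ_LR phi) /=.
Qed.

End LocModule.

End Localization.

Definition residue_field (A : comPzRingType) (P : spec A) : comPzAlgType A :=
  qring (ideal_gen (@loc_map A (prime_compl P) @` P)).

Section Tensor.
Variables (A : comPzRingType) (B C : comPzAlgType A).

(* A list of pairs stands for the sum of the corresponding pure tensors. *)
Inductive tensor_rel : seq (B * C) -> seq (B * C) -> Prop :=
| tensor_refl s : tensor_rel s s
| tensor_sym s t : tensor_rel s t -> tensor_rel t s
| tensor_trans s t r : tensor_rel s t -> tensor_rel t r -> tensor_rel s r
| tensor_cat s s' t t' : tensor_rel s s' -> tensor_rel t t' ->
    tensor_rel (s ++ t) (s' ++ t')
| tensor_catC s t : tensor_rel (s ++ t) (t ++ s)
| tensor_0l c : tensor_rel [:: (0, c)] [::]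
| tensor_Dl x y c : tensor_rel [:: (x + y, c)] [:: (x, c); (y, c)]
| tensor_Dr x c d : tensor_rel [:: (x, c + d)] [:: (x, c); (x, d)]
| tensor_Z a x c : tensor_rel [:: (alg_map a * x, c)] [:: (x, alg_map a * c)].

Definition tensor_eqv (s t : seq (B * C)) : bool := `[< tensor_rel s t >].

Lemma tensor_eqv_refl : reflexive tensor_eqv.
Proof. by move=> s; apply/asboolP/tensor_refl. Qed.

Lemma tensor_eqv_sym : symmetric tensor_eqv.
Proof. by move=> s t; apply/asboolP/asboolP; apply: tensor_sym. Qed.

Lemma tensor_eqv_trans : transitive tensor_eqv.
Proof.
by move=> t s r /asboolP st /asboolP tr; apply/asboolP/(tensor_trans st tr).
Qed.

Canonical tensor_eqv_equiv :=
  EquivRel tensor_eqv tensor_eqv_refl tensor_eqv_sym tensor_eqv_trans.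

Definition tensor := {eq_quot tensor_eqv}.
HB.instance Definition _ : EqQuotient _ tensor_eqv tensor :=
  EqQuotient.on tensor.
HB.instance Definition _ := Choice.on tensor.

Definition tcls (s : seq (B * C)) : tensor := \pi s.

Lemma tclsP s t : tcls s = tcls t <-> tensor_rel s t.
Proof. by split=> [/eqmodP/asboolP|h] //; apply/eqmodP/asboolP. Qed.

Lemma tcls_ind (P : tensor -> Prop) : (forall s, P (tcls s)) -> forall x, P x.
Proof. exact: quotW. Qed.

Lemma tcls_repr x : tcls (repr x) = x.
Proof. exact: reprK. Qed.

Lemma repr_tcls s : tensor_rel (repr (tcls s)) s.
Proof. by apply/tclsP; rewrite tcls_repr. Qed.

Definition pure (x : B) (c : C) : tensor := tcls [:: (x, c)].

Definition tadd (x y : tensor) : tensor := tcls (repr x ++ repr y).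
Definition topp (x : tensor) : tensor :=
  tcls [seq (- p.1, p.2) | p <- repr x].
Definition tmul (x y : tensor) : tensor :=
  tcls [seq (p.1 * q.1, p.2 * q.2) | p <- repr x, q <- repr y].

Lemma taddE s t : tadd (tcls s) (tcls t) = tcls (s ++ t).
Proof. by apply/tclsP/tensor_cat; apply: repr_tcls. Qed.

Lemma taddA : associative tadd.
Proof.
by elim/tcls_ind=> s; elim/tcls_ind=> t; elim/tcls_ind=> r;
  rewrite !taddE catA.
Qed.

Lemma taddC : commutative tadd.
Proof.
by elim/tcls_ind=> s; elim/tcls_ind=> t; rewrite !taddE; apply/tclsP/tensor_catC.
Qed.

Lemma tadd0 : left_id (tcls [::]) tadd.
Proof. by elim/tcls_ind=> s; rewrite taddE. Qed.

Lemma tensor_rel_opp s :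
  tensor_rel ([seq (- p.1, p.2) | p <- s] ++ s) [::].
Proof.
elim: s => [|[x c] s ih] /=; first exact: tensor_refl.
rewrite -cat1s -[(x, c) :: s]cat1s.
apply: (tensor_trans (t := [:: (- x, c); (x, c)]
          ++ ([seq (- p.1, p.2) | p <- s] ++ s))).
  rewrite -[[:: (- x, c); _]]cat1s -catA.
  apply: tensor_cat; first exact: tensor_refl.
  by rewrite !catA; apply: tensor_cat;
     [apply: tensor_catC | apply: tensor_refl].
rewrite -[[::]]cats0; apply: tensor_cat => //.
apply: tensor_trans (tensor_sym (tensor_Dl _ _ _)) _.
by rewrite addNr; apply: tensor_0l.
Qed.

Lemma taddN : left_inverse (tcls [::]) topp tadd.
Proof.
move=> x; rewrite -{2}(tcls_repr x) taddE.
by apply/tclsP/tensor_rel_opp.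
Qed.

HB.instance Definition _ :=
  GRing.isZmodule.Build tensor taddA taddC tadd0 taddN.

Lemma tclsD s t : tcls (s ++ t) = tcls s + tcls t.
Proof. by rewrite /GRing.add /= taddE. Qed.

Lemma pureDl x y c : pure (x + y) c = pure x c + pure y c.
Proof. by rewrite -tclsD; apply/tclsP/tensor_Dl. Qed.

Lemma pureDr x c d : pure x (c + d) = pure x c + pure x d.
Proof. by rewrite -tclsD; apply/tclsP/tensor_Dr. Qed.

Lemma pureZ a x c : pure (alg_map a * x) c = pure x (alg_map a * c).
Proof. exact/tclsP/tensor_Z. Qed.

Lemma tcls_sum s : tcls s = \sum_(p <- s) pure p.1 p.2.
Proof.
elim: s => [|p s ih]; first by rewrite big_nil.
by rewrite big_cons -ih -tclsD -surjective_pairing.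
Qed.

Lemma tensor_rel_lift (V : zmodType) (f : B -> C -> V) :
  (forall x y c, f (x + y) c = f x c + f y c) ->
  (forall x c d, f x (c + d) = f x c + f x d) ->
  (forall a x c, f (alg_map a * x) c = f x (alg_map a * c)) ->
  forall s t, tensor_rel s t ->
    \sum_(p <- s) f p.1 p.2 = \sum_(p <- t) f p.1 p.2.
Proof.
move=> fDl fDr fZ s t; elim=> {s t} //.
- by move=> s t r _ -> _ ->.
- by move=> s s' t t' _ es _ et; rewrite !big_cat /= es et.
- by move=> s t; rewrite !big_cat /= addrC.
- move=> c; rewrite big_seq1 big_nil /=.
  by apply: (addrI (f 0 c)); rewrite -fDl !addr0.
- by move=> x y c; rewrite !big_cons !big_nil !addr0 fDl.
- by move=> x c d; rewrite !big_cons !big_nil !addr0 fDr.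
- by move=> a x c; rewrite !big_seq1 fZ.
Qed.

Lemma tmul_sum s t :
  tcls [seq (p.1 * q.1, p.2 * q.2) | p <- s, q <- t]
  = \sum_(p <- s) \sum_(q <- t) pure (p.1 * q.1) (p.2 * q.2).
Proof. by rewrite tcls_sum big_allpairs_dep. Qed.

Lemma tmul_rel s s' t t' : tensor_rel s s' -> tensor_rel t t' ->
  \sum_(p <- s) \sum_(q <- t) pure (p.1 * q.1) (p.2 * q.2)
  = \sum_(p <- s') \sum_(q <- t') pure (p.1 * q.1) (p.2 * q.2).
Proof.
move=> ss' tt'.
transitivity (\sum_(p <- s) \sum_(q <- t') pure (p.1 * q.1) (p.2 * q.2)).
  apply: eq_bigr => p _.
  apply: (tensor_rel_lift (f := fun x c => pure (p.1 * x) (p.2 * c))) => //.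
  - by move=> x y c; rewrite mulrDr pureDl.
  - by move=> x c d; rewrite mulrDr pureDr.
  - by move=> a x c; rewrite mulrCA pureZ mulrCA.
apply: (tensor_rel_lift
  (f := fun x c => \sum_(q <- t') pure (x * q.1) (c * q.2))) => //.
- move=> x y c; rewrite -big_split; apply: eq_bigr => q _.
  by rewrite mulrDl pureDl.
- move=> x c d; rewrite -big_split; apply: eq_bigr => q _.
  by rewrite mulrDl pureDr.
- by move=> a x c; apply: eq_bigr => q _; rewrite -mulrA pureZ mulrA.
Qed.

Lemma tmulE s t : tmul (tcls s) (tcls t) =
  \sum_(p <- s) \sum_(q <- t) pure (p.1 * q.1) (p.2 * q.2).
Proof. by rewrite /tmul tmul_sum; apply: tmul_rel; apply: repr_tcls. Qed.

Lemma tmul_pure x c y d : tmul (pure x c) (pure y d) = pure (x * y) (c * d).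
Proof. by rewrite tmulE !big_seq1. Qed.

Lemma tmulC : commutative tmul.
Proof.
elim/tcls_ind=> s; elim/tcls_ind=> t; rewrite !tmulE exchange_big.
apply: eq_bigr => q _; apply: eq_bigr => p _.
by rewrite mulrC [_.2 * _]mulrC.
Qed.

Lemma tmulDl : left_distributive tmul +%R.
Proof.
elim/tcls_ind=> s; elim/tcls_ind=> t; elim/tcls_ind=> r.
by rewrite -tclsD !tmulE big_cat.
Qed.

Lemma tensor_ind (P : tensor -> Prop) :
  P 0 -> (forall x c, P (pure x c)) ->
  (forall u v, P u -> P v -> P (u + v)) -> forall u, P u.
Proof.
move=> P0 Pp PD; elim/tcls_ind=> s; rewrite tcls_sum.
by elim/big_ind: _.
Qed.

Lemma tmul0 u : tmul 0 u = 0.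
Proof. by apply: (addrI (tmul 0 u)); rewrite -tmulDl !addr0. Qed.

Lemma tmulDr : right_distributive tmul +%R.
Proof. by move=> u v w; rewrite tmulC tmulDl ![tmul _ u]tmulC. Qed.

Lemma tmulA : associative tmul.
Proof.
move=> u v w; elim/tensor_ind: u => [|x c|u u' hu hu'].
- by rewrite !tmul0.
- elim/tensor_ind: v => [|y d|v v' hv hv'].
  + by rewrite tmul0 [tmul _ 0]tmulC !tmul0.
  + elim/tensor_ind: w => [|z e|w w' hw hw'].
    * by rewrite ![tmul _ 0]tmulC !tmul0 tmulC tmul0.
    * by rewrite !tmul_pure !mulrA.
    * by rewrite !tmulDr hw hw'.
  + by rewrite tmulDl !tmulDr tmulDl hv hv'.
- by rewrite !tmulDl hu hu'.
Qed.

Lemma tmul1 : left_id (pure 1 1) tmul.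
Proof.
elim/tensor_ind=> [|x c|u v hu hv]; first by rewrite tmulC tmul0.
  by rewrite tmul_pure !mul1r.
by rewrite tmulDr hu hv.
Qed.

HB.instance Definition _ := GRing.Zmodule_isComPzRing.Build tensor
  tmulA tmulC tmul1 tmulDl.

Lemma pureM x c y d : pure x c * pure y d = pure (x * y) (c * d).
Proof. exact: tmul_pure. Qed.

Definition tensor_inl (x : B) : tensor := pure x 1.

Lemma tensor_inl_zmod : zmod_morphism tensor_inl.
Proof.
move=> x y; apply: (addIr (tensor_inl y)).
by rewrite subrK /tensor_inl -pureDl subrK.
Qed.

Lemma tensor_inl_monoid : monoid_morphism tensor_inl.
Proof. by split=> // x y; rewrite /tensor_inl pureM mulr1. Qed.

HB.instance Definition _ :=
  GRing.isZmodMorphism.Build B tensor tensor_inl tensor_inl_zmod.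
HB.instance Definition _ :=
  GRing.isMonoidMorphism.Build B tensor tensor_inl tensor_inl_monoid.

End Tensor.

Definition is_basis (R : comPzRingType) (M : lmodType R) n (e : 'I_n -> M) :
  Prop :=
  forall m, exists! c : 'rV[R]_n, m = \sum_i c 0 i *: e i.

Definition finitely_generated (A : comPzRingType) (M : lmodType A) : Prop :=
  exists n (g : 'I_n -> M), forall m, exists c : 'I_n -> A,
    m = \sum_i c i *: g i.

Definition locally_free (A : comPzRingType) (M : lmodType A) : Prop :=
  forall P : spec A, exists f, ~ ideal_set P f /\
    exists n (e : 'I_n -> loc (powers f) M), is_basis e.

Definition finite_locally_free (A : comPzRingType) (M : lmodType A) : Prop :=
  finitely_generated M /\ locally_free M.

(* On every basic open set D(f) over which M is free, d restricts to the
   determinant of the matrix of phi in any basis (coordinates are written as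
   rows, so this is the transpose of the usual matrix). *)
Definition is_det (A : comPzRingType) (M : lmodType A) (phi : {linear M -> M})
    (d : A) : Prop :=
  forall f n (e : 'I_n -> loc (powers f) M) (T : 'M[loc_ring (powers f)]_n),
    is_basis e ->
    (forall i, loc_fun phi (e i) = \sum_j T i j *: e j) ->
    loc_map (powers f) d = \det T.

(* The value 0 is used only if no element satisfies [is_det]; for a finite
   locally free module there is exactly one. *)
Definition module_det (A : comPzRingType) (M : lmodType A)
    (phi : {linear M -> M}) : A :=
  xget 0 [set d | is_det phi d].

Section Main.
Variables (A : comPzRingType) (B : comPzAlgType A).

Definition mu (L : ideal B) (b : B) (u : as_module (qring L)) :
  as_module (qring L) := qcls L b * (u : qring L).

Lemma mu_zmod L b : zmod_morphism (@mu L b).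
Proof. by move=> u v; apply: mulrBr. Qed.

Lemma mu_scalable L b : scalable (@mu L b).
Proof. by move=> a u; rewrite !alg_scaleE /mu mulrCA. Qed.

HB.instance Definition _ L b :=
  GRing.isZmodMorphism.Build _ _ (@mu L b) (mu_zmod b).
HB.instance Definition _ L b :=
  GRing.isScalable.Build A _ _ *:%R (@mu L b) (mu_scalable b).

Definition fiber_ring (P : spec A) := tensor B (residue_field P).

Definition fiber_ideal (L : ideal B) (P : spec A) : ideal (fiber_ring P) :=
  ideal_gen (@tensor_inl A B (residue_field P) @` L).

Definition regular_locus (L : ideal B) (b : B) : set (spec A) :=
  [set P | regular_mod (fiber_ideal L P) (tensor_inl (residue_field P) b)].

End Main.

Arguments mu {A B} L b u.

(* Main.v *)
(* Localize at a prime P.  The sequences 0 -> B/I -> B/I x B/J -> B/J -> 0 and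
   0 -> B/(I n J) -> B/I x B/J -> B/(I + J) -> 0 are exact and compatible with
   multiplication by b, so both products compute the determinant of b on
   (B/I x B/J)_P, and the formula holds because it holds at every P.

   For the loci, a basis of (B/L)_P identifies the fiber of B/L at P with a
   finite-dimensional vector space over the residue field, on which b acts by
   the reduction of its matrix; it acts injectively iff det(mu_b^L) is not in P.
   As P is prime, each side of the second claim is the set of primes not
   containing the corresponding side of the determinant formula. *)

From HB Require Import structures.
From mathcomp Require Import all_boot all_order all_algebra ring.
From mathcomp Require Import boolp classical_sets.
Require Import Defs.

Set Implicit Arguments.
Unset Strict Implicit.
Unset Printing Implicit Defensive.

Import GRing.Theory.
Local Open Scope classical_set_scope.
Local Open Scope ring_scope.

(** * Sylvester's determinant identity and rectangular conjugation *)

Section Sylvester.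
Variable R : comPzRingType.

(** Two block matrices multiplied in both orders give block triangular products, with diagonals
    [1 + X Y, 1] and [1, 1 + Y X]; the two products have the same determinant. *)
Lemma det_sylvester m n (X : 'M[R]_(m, n)) (Y : 'M[R]_(n, m)) :
  \det (1%:M + X *m Y) = \det (1%:M + Y *m X).
Proof.
have e1 := det_mulmx (block_mx 1%:M X (- Y) 1%:M) (block_mx 1%:M 0 Y 1%:M).
have e2 := det_mulmx (block_mx 1%:M 0 Y 1%:M) (block_mx 1%:M X (- Y) 1%:M).
move: e1 e2; rewrite !mulmx_block.
rewrite !(mul1mx, mulmx1, mul0mx, mulmx0, addr0, add0r, addNr, subrr).
rewrite !(det_lblock, det_ublock, det1, mul1r, mulr1) => -> <-.
by rewrite addrC.
Qed.

(** Since [P Q = 1], the conjugate equals [1 + P ((T - 1) Q)]. Sylvester's identity moves [P] to the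
    other end, where [Q P = 1] restores [T], even when [m] and [n] differ. *)
Lemma det_conj m n (P : 'M[R]_(m, n)) (Q : 'M[R]_(n, m)) (T : 'M[R]_n) :
  P *m Q = 1%:M -> Q *m P = 1%:M -> \det (P *m T *m Q) = \det T.
Proof.
move=> PQ QP.
have -> : P *m T *m Q = 1%:M + P *m ((T - 1%:M) *m Q).
  by rewrite mulmxBl mulmxBr mul1mx PQ mulmxA addrC subrK.
by rewrite det_sylvester -mulmxA QP mulmx1 addrC subrK.
Qed.

End Sylvester.

(** * Free modules: coordinates, change of basis, determinants in exact sequences *)

Section Bases.
Variables (R : comPzRingType).
Implicit Types M N : lmodType R.

Definition lincomb M n (e : 'I_n -> M) (v : 'rV[R]_n) : M :=
  \sum_i v 0 i *: e i.

Lemma lincomb_is_linear M n (e : 'I_n -> M) : linear (lincomb e).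
Proof.
move=> a u v; rewrite /lincomb scaler_sumr -big_split /=.
by apply: eq_bigr => i _; rewrite !mxE scalerDl scalerA.
Qed.

HB.instance Definition _ M n (e : 'I_n -> M) :=
  GRing.isLinear.Build R 'rV[R]_n M _ (lincomb e) (lincomb_is_linear e).

Lemma lincomb_delta M n (e : 'I_n -> M) i : lincomb e (delta_mx 0 i) = e i.
Proof.
rewrite /lincomb (bigD1 i) //= mxE !eqxx scale1r big1 ?addr0 // => j ji.
by rewrite mxE (negPf ji) andbF scale0r.
Qed.

Lemma linear_lincomb M N n (e : 'I_n -> M) (f : {linear M -> N}) v :
  f (lincomb e v) = lincomb (f \o e) v.
Proof. by rewrite linear_sum /=; apply: eq_bigr => i _; rewrite linearZ. Qed.

Lemma eq_lincomb M n (e f : 'I_n -> M) : e =1 f -> lincomb e =1 lincomb f.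
Proof. by move=> ef v; apply: eq_bigr => i _; rewrite ef. Qed.

Lemma lincomb_mulmx M m n (e : 'I_n -> M) (P : 'M[R]_(m, n)) v :
  lincomb e (v *m P) = lincomb (fun i => lincomb e (row i P)) v.
Proof.
rewrite mulmx_sum_row linear_sum /lincomb; apply: eq_bigr => i _.
by rewrite -/(lincomb e _) linearZ.
Qed.

Lemma lincomb_row_mx M m n (e : 'I_m -> M) (f : 'I_n -> M) v w :
  lincomb (fun k => match split k with inl a => e a | inr b => f b end)
    (row_mx v w) = lincomb e v + lincomb f w.
Proof.
rewrite /lincomb big_split_ord /=; congr (_ + _); apply: eq_bigr => i _.
  by rewrite row_mxEl (unsplitK (inl i)).
by rewrite row_mxEr (unsplitK (inr i)).
Qed.

Lemma basisP M n (e : 'I_n -> M) : is_basis e <->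
  exists c : M -> 'rV[R]_n, cancel c (lincomb e) /\ cancel (lincomb e) c.
Proof.
split=> [eB|[c [cK eK]] m].
  have [c cP] := choice eB; exists c; split=> [m|v]; first by case: (cP m) => /esym.
  by case: (cP (lincomb e v)) => _; apply.
exists (c m); split=> [|v mv]; first exact/esym/cK.
by rewrite mv eK.
Qed.

Lemma lincomb_inj M n (e : 'I_n -> M) : is_basis e -> injective (lincomb e).
Proof. by case/basisP=> c [_ /can_inj]. Qed.

Lemma coord_mx M m n (e : 'I_n -> M) (u : 'I_m -> M) : is_basis e ->
  exists P : 'M[R]_(m, n), forall i, u i = lincomb e (row i P).
Proof.
case/basisP=> c [cK _]; exists (\matrix_i c (u i)) => i.
by rewrite rowK cK.
Qed.

Lemma linear_coord M n (e : 'I_n -> M) :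
  is_basis e -> exists c : {linear M -> 'rV[R]_n},
    cancel c (lincomb e) /\ cancel (lincomb e) c.
Proof.
case/basisP=> c [cK eK]; have cL := can2_linear eK cK.
pose C : {linear M -> 'rV[R]_n} := HB.pack c (GRing.isLinear.Build R _ _ _ c cL).
by exists C.
Qed.

(* The size of the basis is not fixed by M: over the zero ring it is arbitrary,
   which is why independence of the basis goes through [det_sylvester]. *)
Definition free_det M (phi : M -> M) (x : R) : Prop :=
  exists n (e : 'I_n -> M) (T : 'M[R]_n),
    [/\ is_basis e, forall i, phi (e i) = lincomb e (row i T) & x = \det T].

(** Row [i] of [P *m Q] holds the coordinates of [e i] in [e] itself. *)
Lemma base_change_inv M m n (e : 'I_m -> M) (f : 'I_n -> M)
    (P : 'M[R]_(m, n)) (Q : 'M[R]_(n, m)) :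
  is_basis e -> (forall i, e i = lincomb f (row i P)) ->
  (forall j, f j = lincomb e (row j Q)) -> P *m Q = 1%:M.
Proof.
move=> eB eP fQ; apply/row_matrixP => i; apply: (lincomb_inj eB).
by rewrite row_mul lincomb_mulmx -(eq_lincomb fQ) -eP row1 lincomb_delta.
Qed.

(** With transition matrices [P] and [Q] between the bases, [T = P U Q], so [det_conj] applies. *)
Lemma free_det_uniq M (phi : {linear M -> M}) x y :
  free_det phi x -> free_det phi y -> x = y.
Proof.
move=> [m [e [T [eB eT ->]]]] [n [f [U [fB fU ->]]]].
have [P eP] := coord_mx e fB; have [Q fQ] := coord_mx f eB.
rewrite -(det_conj U (base_change_inv eB eP fQ) (base_change_inv fB fQ eP)).
congr (\det _); apply/row_matrixP => i; apply: (lincomb_inj eB).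
rewrite -eT eP linear_lincomb (eq_lincomb fU) -lincomb_mulmx.
by rewrite !row_mul [RHS]lincomb_mulmx -(eq_lincomb fQ).
Qed.

(** The images of a basis of [M1] together with lifts of a basis of [M3] form a basis of [M2]. In it
    the matrix of [phi2] is block lower triangular, coordinates being rows, with diagonal blocks [T]
    and [U]. *)
Lemma free_det_exact M1 M2 M3 (i : {linear M1 -> M2}) (p : {linear M2 -> M3})
    (phi1 : {linear M1 -> M1}) (phi2 : {linear M2 -> M2})
    (phi3 : {linear M3 -> M3}) x1 x3 :
  injective i -> (forall z, exists y, p y = z) ->
  (forall y, p y = 0 <-> exists x, y = i x) ->
  (forall x, phi2 (i x) = i (phi1 x)) ->
  (forall y, p (phi2 y) = phi3 (p y)) ->
  free_det phi1 x1 -> free_det phi3 x3 -> free_det phi2 (x1 * x3).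
Proof.
move=> i_inj p_surj ker_p phi_i phi_p.
move=> [m [e [T [eB eT ->]]]] [n [f [U [fB fU ->]]]].
have [g gf] := choice (fun j => p_surj (f j)).
have pi0 x : p (i x) = 0 by apply/ker_p; exists x.
have pg : p \o g =1 f by [].
pose h k := match split k with inl a => i (e a) | inr b => g b end.
have hE v w : lincomb h (row_mx v w) = i (lincomb e v) + lincomb g w.
  by rewrite lincomb_row_mx -linear_lincomb.
have ph v w : p (lincomb h (row_mx v w)) = lincomb f w.
  by rewrite hE linearD pi0 add0r linear_lincomb (eq_lincomb pg).
have h_span y : exists v : 'rV_(m + n), y = lincomb h v.
  have [d [dK _]] := (basisP f).1 fB; have [c [cK _]] := (basisP e).1 eB.
  have /ker_p[x xE] : p (y - lincomb g (d (p y))) = 0.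
    by rewrite linearB linear_lincomb (eq_lincomb pg) dK subrr.
  exists (row_mx (c x) (d (p y))).
  by rewrite hE cK -xE subrK.
have h_inj : injective (lincomb h).
  move=> v w; rewrite -[v]hsubmxK -[w]hsubmxK => vw.
  have := congr1 p vw; rewrite !ph => /(lincomb_inj fB) rE.
  by move: vw; rewrite !hE rE => /addIr/i_inj/(lincomb_inj eB) ->.
have hB : is_basis h.
  by move=> y; have [v yv] := h_span y; exists v; split=> // w; rewrite yv => /h_inj.
(* Applying [p] forces the last [n] coordinates of [phi2 (g j)] to be row [j] of [U]; the first [m]
   are unconstrained and are collected in [X]. *)
have [X gX] : exists X : 'M[R]_(n, m), forall j,
    phi2 (g j) = lincomb h (row_mx (row j X) (row j U)).
  have /choice[X gX] j : exists x : 'rV[R]_m,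
      phi2 (g j) = lincomb h (row_mx x (row j U)).
    have [v vE] := h_span (phi2 (g j)); exists (lsubmx v).
    suff <- : rsubmx v = row j U by rewrite hsubmxK.
    apply: (lincomb_inj fB); rewrite -fU -(ph (lsubmx v)) hsubmxK -vE phi_p.
    by congr (phi3 _); exact: pg.
  by exists (\matrix_j X j) => j; rewrite rowK.
exists (m + n)%N, h, (block_mx T 0 X U); split; rewrite ?det_lblock // => k.
rewrite /h /block_mx; case: split_ordP => j ->.
  by rewrite rowKu row_row_mx row0 -/h hE linear0 addr0 phi_i eT.
by rewrite rowKd row_row_mx -/h.
Qed.

End Bases.

(** * Prime ideals, and gluing of sections over Spec A *)

Section Primes.
Variable A : comPzRingType.
Implicit Types (I J : ideal A) (P : spec A).

Definition principal (x : A) : ideal A.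
Proof.
refine (@Ideal A [set a * x | a in setT] _ _ _).
- by exists 0; rewrite ?mul0r.
- by move=> _ _ [a _ <-] [b _ <-]; exists (a + b); rewrite ?mulrDl.
- by move=> c _ [a _ <-]; exists (c * a); rewrite ?mulrA.
Defined.

Lemma maximal_prime I : ~ ideal_set I 1 ->
  (forall J, ideal_set I `<=` ideal_set J -> ~ ideal_set J 1 ->
     ideal_set J `<=` ideal_set I) -> prime_ideal I.
Proof.
move=> I1 Imax; split=> // x y Ixy; apply: contrapT => /not_orP[Ix Iy].
have [] := pselect (ideal_set (ideal_add I (principal x)) 1).
  move=> [k [_ [Ik [a _ <-] e]]]; apply: Iy.
  rewrite -[y]mul1r e mulrDl; apply: idealD; first by rewrite mulrC; apply: idealMl.
  by rewrite -mulrA; apply: idealMl.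
move=> J1; apply: Ix; apply: (Imax _ _ J1) => [z Iz|].
  by exists z, 0; split=> //; [apply: ideal0 | rewrite addr0].
by exists 0, x; split; rewrite ?add0r //; [apply: ideal0 | exists 1; rewrite ?mul1r].
Qed.

Lemma prime_above I : ~ ideal_set I 1 ->
  exists P, ideal_set I `<=` ideal_set P.
Proof.
move=> I1.
(* Zorn's lemma is applied to sets whose union with [I] is a proper ideal, not to ideals containing
   [I]: the empty chain has empty union, which must be admissible too. *)
pose ok (X : set A) := exists2 K : ideal A,
  ideal_set K = X `|` ideal_set I & ~ ideal_set K 1.
have [|X [[K KE K1] Xmax]] := @Zorn_bigcup A ok.
  move=> F Fok Ftot.
  have FK X : F X -> exists2 K : ideal A,
     ideal_set K = X `|` ideal_set I & ~ ideal_set K 1 by move/Fok.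
  (* Because [F] is a chain, two elements of the union lie in a single ideal [K], either [I] or a
     member of [F] joined with [I]. *)
  have sub x y : (\bigcup_(X in F) X `|` ideal_set I) x ->
      (\bigcup_(X in F) X `|` ideal_set I) y -> exists2 K : ideal A,
      ideal_set K x /\ ideal_set K y &
      ideal_set K `<=` \bigcup_(X in F) X `|` ideal_set I.
    have one z : (\bigcup_(X in F) X `|` ideal_set I) z ->
       ideal_set I z \/ exists2 X, F X & X z.
      by case=> [[X FX Xz]|]; [right; exists X|left].
    have sub1 X : F X -> X `|` ideal_set I `<=` \bigcup_(X in F) X `|` ideal_set I.
      by move=> FX z [Xz|]; [left; exists X|right].
    move=> /one[Ix|[X FX Xx]] /one[Iy|[Y FY Yy]].
    - by exists I => // z; right.
    - have [K KE _] := FK _ FY; exists K; rewrite KE; last exact: sub1.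
      by split; [right|left].
    - have [K KE _] := FK _ FX; exists K; rewrite KE; last exact: sub1.
      by split; [left|right].
    - case: (Ftot _ _ FX FY) => [XY|YX].
        have [K KE _] := FK _ FY; exists K; rewrite KE; last exact: sub1.
        by split; left=> //; apply: XY.
      have [K KE _] := FK _ FX; exists K; rewrite KE; last exact: sub1.
      by split; left=> //; apply: YX.
  unshelve eexists.
    refine (@Ideal A (\bigcup_(X in F) X `|` ideal_set I) _ _ _).
    - by right; apply: ideal0.
    - move=> x y hx hy; have [K [Kx Ky]] := sub _ _ hx hy.
      by apply; apply: idealD.
    - move=> a x hx; have [K [Kx _]] := sub _ _ hx hx.
      by apply; apply: idealMl.
  - by [].
  - move=> /= [[X FX X1]|//]; have [K KE] := FK _ FX.
    by apply; rewrite KE; left.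
have IK : ideal_set I `<=` ideal_set K by rewrite KE => x; right.
suff Kp : prime_ideal K by exists (Spec Kp).
apply: maximal_prime => // J KJ J1 x Jx; apply: contrapT => Kx.
apply: (Xmax (ideal_set J)); last first.
  exists J => //; apply/seteqP; split=> [y|y [|/IK/KJ]] //; by left.
split=> [y Xy|JX]; first by apply: KJ; rewrite KE; left.
by apply: Kx; rewrite KE; left; apply: JX.
Qed.

(** This is the local-to-global tool below: the elements for which a property holds are shown to
    form an ideal, and it then suffices to find one such element outside each prime. It takes the
    place of explicit partitions of unity. *)
Lemma unit_ideal I : (forall P, exists2 s, ideal_set I s & ~ ideal_set P s) ->
  ideal_set I 1.
Proof.
move=> IP; apply: contrapT => /prime_above[P sIP].
by have [s /sIP] := IP P.
Qed.

Lemma primeX P x n : ~ ideal_set P x -> ~ ideal_set P (x ^+ n).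
Proof.
move=> Px; elim: n => [|n ih]; first by case: (spec_prime P).
by rewrite exprS => /(spec_prime P).2[].
Qed.

Lemma primeM P x y : ~ ideal_set P x -> ~ ideal_set P y -> ~ ideal_set P (x * y).
Proof. by move=> Px Py /(spec_prime P).2[]. Qed.

(** The annihilator of the image of [x] in the localization of [A] at the powers of [s]; for [s = 1]
    it is the plain annihilator of [x]. *)
Definition ann (s x : A) : ideal A.
Proof.
refine (@Ideal A [set u | exists k, s ^+ k * (u * x) = 0] _ _ _).
- by exists 0%N; rewrite mul0r mulr0.
- move=> u v [k uk] [l vl]; exists (k + l)%N.
  rewrite exprD -[RHS](mulr0 (s ^+ k + s ^+ l)) mulrDl mulrDr mulrDl.
  transitivity (s ^+ l * (s ^+ k * (u * x)) + s ^+ k * (s ^+ l * (v * x))); first by ring.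
  by rewrite uk vl !mulr0 addr0.
- move=> a u [k uk]; exists k.
  by transitivity (a * (s ^+ k * (u * x))); [ring | rewrite uk mulr0].
Defined.

(* Membership of [(s, a)] in [D] reads "the section equals [a / s] on D(s)". *)
Lemma glue (D : set (A * A)) :
  (forall P, exists2 p, D p & ~ ideal_set P p.1) ->
  (forall p q, D p -> D q -> exists m, (p.1 * q.1) ^+ m * (p.1 * q.2 - q.1 * p.2) = 0) ->
  exists d, forall p, D p -> exists m, p.1 ^+ m * (p.1 * d - p.2) = 0.
Proof.
move=> Dcov Dcomp.
have [l lD lcov] : exists2 l : seq (A * A), (forall p, p \in l -> D p) &
    forall P, exists2 p, p \in l & ~ ideal_set P p.1.
  (* Quasi-compactness: [fin u l] says that finitely many members of [D] cover D(u). The [u]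
     admitting such a list form an ideal [U], and [1] belongs to it. *)
  pose fin u (l : seq (A * A)) := (forall p, p \in l -> D p) /\
    forall P, ~ ideal_set P u -> exists2 p, p \in l & ~ ideal_set P p.1.
  have @U : ideal A.
    refine (@Ideal A [set u | exists l, fin u l] _ _ _).
    - by exists [::]; split=> // P []; apply: ideal0.
    - move=> u v [l [lD lP]] [r [rD rP]]; exists (l ++ r); split=> [p|P Puv].
        by rewrite mem_cat => /orP[/lD|/rD].
      have [Pu|Pu] := pselect (ideal_set P u); last first.
        by have [p pl Pp] := lP P Pu; exists p; rewrite // mem_cat pl.
      have [Pv|Pv] := pselect (ideal_set P v); first by case: Puv; apply: idealD.
      by have [p pl Pp] := rP P Pv; exists p; rewrite // mem_cat pl orbT.
    - move=> a u [l [lD lP]]; exists l; split=> // P Pau.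
      by apply: lP => Pu; apply: Pau; apply: idealMl.
  have [P|l [lD lP]] := @unit_ideal U.
    have [p Dp Pp] := Dcov P; exists p.1 => //; exists [:: p].
    by split=> [q|Q Qp]; [rewrite inE => /eqP -> | exists p; rewrite ?inE].
  by exists l => // P; apply: lP; case: (spec_prime P).
(* Finiteness of [l] yields one exponent valid for all [q] in [l]. *)
have lcomp : forall p, D p -> exists m, forall q, q \in l ->
    (p.1 * q.1) ^+ m * (p.1 * q.2 - q.1 * p.2) = 0.
  move=> p Dp; elim: l lD {lcov} => [|q l ih] lD; first by exists 0%N.
  have [|m mE] := ih; first by move=> r rl; apply: lD; rewrite inE rl orbT.
  have [n nE] := Dcomp _ _ Dp (lD q (mem_head _ _)).
  exists (m + n)%N => r; rewrite inE => /orP[/eqP ->|rl]; rewrite exprD.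
    by rewrite -mulrA nE mulr0.
  by rewrite mulrAC mE // mul0r.
have [d dE] : exists d, forall q, q \in l -> exists k, q.1 ^+ k * (q.2 - q.1 * d) = 0.
  (* [C] consists of the [s] for which [s] times the section is given on the list by a global
     element [a]. For [p] in the list it contains [p.1 ^+ m.+1], with [a = p.1 ^+ m * p.2]: one
     factor clears the denominator of [p.2 / p.1], the other [m] absorb the exponent of [lcomp]. *)
  have @C : ideal A.
    refine (@Ideal A [set s | exists a, forall q, q \in l ->
      exists k, q.1 ^+ k * (s * q.2 - q.1 * a) = 0] _ _ _).
    - by exists 0 => q _; exists 0%N; ring.
    - move=> s t [a sa] [b tb]; exists (a + b) => q ql.
      have [j jE] := sa q ql; have [k kE] := tb q ql; exists (j + k)%N; rewrite exprD.
      transitivity (q.1 ^+ k * (q.1 ^+ j * (s * q.2 - q.1 * a))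
        + q.1 ^+ j * (q.1 ^+ k * (t * q.2 - q.1 * b))); first by ring.
      by rewrite jE kE !mulr0 addr0.
    - move=> c s [a sa]; exists (c * a) => q ql.
      have [j jE] := sa q ql; exists j.
      transitivity (c * (q.1 ^+ j * (s * q.2 - q.1 * a))); first by ring.
      by rewrite jE mulr0.
  have [P|d dE] := @unit_ideal C.
    have [p pl Pp] := lcov P; have [m mE] := lcomp p (lD p pl).
    exists (p.1 ^+ m.+1); last exact: primeX.
    exists (p.1 ^+ m * p.2) => q ql; exists m.
    by rewrite -(mE q ql) exprMn exprS; ring.
  by exists d => q ql; have [k] := dE q ql; rewrite mul1r; exists k.
exists d => p Dp; have [m mE] := lcomp p Dp.
(* So far [d] is compared only with the members of [l]. For any other [p] in [D], the annihilator of
   the discrepancy over D(p.1) contains a power of every [q.1], because [p] agrees with [q] and [q]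
   agrees with [d]. *)
suff [k] : ideal_set (ann p.1 (p.1 * d - p.2)) 1 by rewrite mul1r; exists k.
apply: unit_ideal => P; have [q ql Pq] := lcov P; have [k kE] := dE q ql.
exists (q.1 ^+ (m + k).+1); last exact: primeX.
exists m.
transitivity (q.1 ^+ k * ((p.1 * q.1) ^+ m * (p.1 * q.2 - q.1 * p.2))
  - (p.1 * q.1) ^+ m * p.1 * (q.1 ^+ k * (q.2 - q.1 * d))).
  by rewrite exprMn exprS exprD; ring.
by rewrite mE // kE !mulr0 subr0.
Qed.

End Primes.

(** * Localization: universal property, functoriality, exactness *)

Section Lift.
Variables (A : comPzRingType) (S : mulset A) (M : lmodType A).

Lemma den1 : den (ms_one S) = 1. Proof. by []. Qed.

Lemma frac_scale1 (m : M) (s : S) : frac m s = rfrac 1 s *: frac m (ms_one S).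
Proof.
by rewrite fracZ scale1r; apply: eq_frac; rewrite ms_mulE den1 mulr1.
Qed.

Lemma rfrac_invK (s : S) : rfrac 1 s * loc_map S (den s) = 1.
Proof.
rewrite /loc_map rfracM -[RHS]/(rfrac 1 (ms_one S)).
by apply: eq_rfrac; rewrite ms_mulE !den1 !mul1r !mulr1.
Qed.

Variables (N : lmodType (loc_ring S)) (h : M -> N).
Hypotheses (hD : {morph h : m n / m + n})
  (hZ : forall a m, h (a *: m) = loc_map S a *: h m).

Definition loc_lift (x : loc S M) : N := rfrac 1 (repr x).2 *: h (repr x).1.

Lemma loc_liftE m s : loc_lift (frac m s) = rfrac 1 s *: h m.
Proof.
case: (repr_frac m s) => u; rewrite /loc_lift.
move: (repr _) => [n t] /= /(congr1 h); rewrite !hZ => e.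
(* Multiplying by the inverses of [u], [t] and [s], which act on [N], turns the relation between the
   two fractions into [h n / t = h m / s]. *)
have := congr1 (fun y => (rfrac 1 u * rfrac 1 t * rfrac 1 s) *: y) e.
rewrite !scalerA.
have E (x y z : loc_ring S) : rfrac 1 u * x * y * loc_map S (den u) * z
    = rfrac 1 u * loc_map S (den u) * (x * y * z) by ring.
rewrite !E rfrac_invK !mul1r -mulrA rfrac_invK mulr1.
rewrite [rfrac 1 t * rfrac 1 s]mulrC -mulrA rfrac_invK mulr1.
exact.
Qed.

Lemma loc_lift_is_linear : linear loc_lift.
Proof.
move=> x y z; elim/loc_ring_ind: x => a r.
elim/loc_ind: y => m s; elim/loc_ind: z => n t.
rewrite fracZ fracD !loc_liftE hD !hZ scalerDr !scalerA.
by congr (_ *: _ + _ *: _); rewrite /loc_map !rfracM;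
  apply: eq_rfrac; rewrite !ms_mulE !den1; ring.
Qed.

HB.instance Definition _ :=
  GRing.isLinear.Build (loc_ring S) (loc S M) N _ loc_lift loc_lift_is_linear.

End Lift.

Section LocFun.
Variables (A : comPzRingType) (S : mulset A).
Implicit Types M N : lmodType A.

Lemma frac_den1D M (m n : M) :
  frac (m + n) (ms_one S) = frac m (ms_one S) + frac n (ms_one S).
Proof. by rewrite fracD; apply: eq_frac; rewrite ms_mulE !den1 mul1r !scale1r. Qed.

Lemma frac_den1Z M a (m : M) :
  frac (a *: m) (ms_one S) = loc_map S a *: frac m (ms_one S).
Proof. by rewrite fracZ; apply: eq_frac; rewrite ms_mulE !den1 mul1r. Qed.

Lemma frac0 M (s : S) : frac (0 : M) s = 0.
Proof. by apply: (eq_frac (t := ms_one S)); rewrite !scaler0. Qed.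

Lemma frac_eq0 M (m : M) (s : S) :
  frac m s = 0 <-> exists u : S, den u *: m = 0.
Proof.
rewrite -(frac0 M (ms_one S)) fracP den1.
by split=> -[u uE]; exists u; move: uE; rewrite !(scale1r, scaler0).
Qed.

Definition locf M N (h : {linear M -> N}) : loc S M -> loc S N :=
  loc_lift (fun m => frac (h m) (ms_one S)).

Section Locf.
Variables (M N : lmodType A) (h : {linear M -> N}).

Let hD : {morph (fun m => frac (h m) (ms_one S)) : m n / m + n}.
Proof. by move=> m n; rewrite linearD frac_den1D. Qed.

Let hZ a m : frac (h (a *: m)) (ms_one S) = loc_map S a *: frac (h m) (ms_one S).
Proof. by rewrite linearZ frac_den1Z. Qed.

Lemma locf_is_linear : linear (locf h).
Proof. exact: loc_lift_is_linear. Qed.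

HB.instance Definition _ :=
  GRing.isLinear.Build (loc_ring S) (loc S M) (loc S N) _ (locf h) locf_is_linear.

Lemma locfE m s : locf h (frac m s) = frac (h m) s.
Proof. by rewrite /locf loc_liftE // -frac_scale1. Qed.

Lemma locf_inj : injective h -> injective (locf h).
Proof.
move=> h_inj; apply: raddf_inj => x; elim/loc_ind: x => m s.
rewrite /= locfE => /frac_eq0[u]; rewrite -linearZ -(linear0 h) => /h_inj um.
by apply/frac_eq0; exists u.
Qed.

Lemma locf_surj : (forall n, exists m, h m = n) -> forall y, exists x, locf h x = y.
Proof.
move=> h_surj; elim/loc_ind=> n s; have [m <-] := h_surj n.
by exists (frac m s); rewrite locfE.
Qed.

End Locf.

(** If [u] kills [p m], then [u m = i n] for some [n], whence [m / s = i n / (u s)]. *)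
Lemma locf_exact (M1 M2 M3 : lmodType A) (i : {linear M1 -> M2})
    (p : {linear M2 -> M3}) :
  (forall y, p y = 0 <-> exists x, y = i x) ->
  forall y, locf p y = 0 <-> exists x, y = locf i x.
Proof.
move=> ip; elim/loc_ind=> m s; rewrite locfE; split=> [/frac_eq0[u]|[x]].
  rewrite -linearZ => /ip[n un]; exists (frac n (ms_mul u s)).
  by rewrite locfE -un; apply: eq_frac; rewrite scalerA ms_mulE mulrC.
elim/loc_ind: x => n t; rewrite -(locfE p) (locfE i) => ->; rewrite locfE.
have -> : p (i n) = 0 by apply/ip; exists n.
by rewrite frac0.
Qed.

Section LocEndo.
Variables (M : lmodType A) (phi : {linear M -> M}).

Lemma loc_funEf : loc_fun phi =1 @locf M M phi.
Proof. by elim/loc_ind=> m s; rewrite loc_funE locfE. Qed.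

Lemma loc_fun_is_linear : linear (@loc_fun A S M phi).
Proof. by move=> a x y; rewrite !loc_funEf linearP. Qed.

HB.instance Definition _ := GRing.isLinear.Build (loc_ring S) (loc S M) (loc S M)
   _ (@loc_fun A S M phi) loc_fun_is_linear.

End LocEndo.

Lemma free_det_loc_exact (M1 M2 M3 : lmodType A) (i : {linear M1 -> M2})
    (p : {linear M2 -> M3})
    (phi1 : {linear M1 -> M1}) (phi2 : {linear M2 -> M2})
    (phi3 : {linear M3 -> M3}) x1 x3 :
  injective i -> (forall z, exists y, p y = z) ->
  (forall y, p y = 0 <-> exists x, y = i x) ->
  (forall x, phi2 (i x) = i (phi1 x)) ->
  (forall y, p (phi2 y) = phi3 (p y)) ->
  free_det (@loc_fun A S M1 phi1) x1 -> free_det (@loc_fun A S M3 phi3) x3 ->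
  free_det (@loc_fun A S M2 phi2) (x1 * x3).
Proof.
move=> i_inj p_surj ip phi_i phi_p; apply: (free_det_exact (i := locf i) (p := locf p)).
- exact: locf_inj.
- exact: locf_surj.
- exact: locf_exact.
- by elim/loc_ind=> m s; rewrite /= !(locfE, loc_funE) phi_i.
- by elim/loc_ind=> m s; rewrite /= !(locfE, loc_funE) phi_p.
Qed.

End LocFun.

(** * Enlarging the set of denominators *)

Section LocIncl.
Variables (A : comPzRingType) (S S' : mulset A).
Hypothesis SS' : mulset_set S `<=` mulset_set S'.

Definition den_incl (s : S) : S' := SigSub (mem_set (SS' (set_mem (valP s)))).

Lemma den_inclE s : den (den_incl s) = den s. Proof. by []. Qed.

Definition loc_incl (M : lmodType A) (x : loc S M) : loc S' M :=
  frac (repr x).1 (den_incl (repr x).2).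

Lemma loc_inclE (M : lmodType A) (m : M) s :
  loc_incl (frac m s) = frac m (den_incl s).
Proof.
apply/fracP; have [u] := repr_frac m s.
by exists (den_incl u); rewrite !den_inclE.
Qed.

Definition ring_incl (x : loc_ring S) : loc_ring S' := @loc_incl A^o x.

Lemma ring_inclE a s : ring_incl (rfrac a s) = rfrac a (den_incl s).
Proof. exact: (@loc_inclE A^o). Qed.

Lemma ring_incl_loc_map a : ring_incl (loc_map S a) = loc_map S' a.
Proof. by rewrite ring_inclE; apply: eq_rfrac. Qed.

Lemma loc_inclD (M : lmodType A) : {morph @loc_incl M : x y / x + y}.
Proof.
elim/loc_ind=> m s; elim/loc_ind=> n t.
by rewrite fracD !loc_inclE fracD; apply: eq_frac; rewrite !ms_mulE.
Qed.

Lemma loc_inclZ (M : lmodType A) x (y : loc S M) :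
  loc_incl (x *: y) = ring_incl x *: loc_incl y.
Proof.
elim/loc_ring_ind: x => a s; elim/loc_ind: y => m t.
by rewrite fracZ loc_inclE ring_inclE loc_inclE fracZ; apply: eq_frac; rewrite !ms_mulE.
Qed.

Lemma ring_incl_zmod : zmod_morphism ring_incl.
Proof.
move=> x y; rewrite -[in RHS](subrK y x); apply: esym.
by rewrite [ring_incl (_ + _)](@loc_inclD A^o) addrK.
Qed.

Lemma ring_incl_monoid : monoid_morphism ring_incl.
Proof.
split=> [|x y]; last exact: (@loc_inclZ A^o).
exact: (ring_incl_loc_map 1).
Qed.

HB.instance Definition _ := GRing.isZmodMorphism.Build (loc_ring S) (loc_ring S')
  ring_incl ring_incl_zmod.
HB.instance Definition _ := GRing.isMonoidMorphism.Build (loc_ring S) (loc_ring S')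
  ring_incl ring_incl_monoid.

Lemma loc_incl_lincomb (M : lmodType A) n (e : 'I_n -> loc S M) v :
  loc_incl (lincomb e v) = lincomb (@loc_incl M \o e) (map_mx ring_incl v).
Proof.
rewrite /lincomb; have i0 : loc_incl (0 : loc S M) = 0.
  by rewrite -(frac0 M (ms_one S)) loc_inclE frac0.
rewrite (big_morph _ (@loc_inclD M) i0); apply: eq_bigr => i _.
by rewrite loc_inclZ mxE.
Qed.

(** The inverse coordinate map comes from the universal property: [m] goes to the coordinates of
    [m / 1] over [S], read over [S'], and this extends to fractions with denominators in [S']. *)
Lemma loc_incl_basis (M : lmodType A) n (e : 'I_n -> loc S M) :
  is_basis e -> is_basis (@loc_incl M \o e).
Proof.
move=> /linear_coord[c [cK eK]].
pose h m := map_mx ring_incl (c (frac m (ms_one S))).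
have hD : {morph h : m n / m + n} by move=> m k; rewrite /h frac_den1D linearD map_mxD.
have hZ a m : h (a *: m) = loc_map S' a *: h m.
  by rewrite /h frac_den1Z linearZ map_mxZ /= ring_incl_loc_map.
pose d : loc S' M -> 'rV_n := loc_lift h.
have dE y : d (loc_incl y) = map_mx ring_incl (c y).
  elim/loc_ind: y => m s; rewrite loc_inclE /d loc_liftE // (frac_scale1 m s).
  by rewrite linearZ map_mxZ /= ring_inclE.
have dL : linear d by exact: loc_lift_is_linear.
pose D : {linear loc S' M -> 'rV_n} := HB.pack d (GRing.isLinear.Build _ _ _ _ d dL).
apply/basisP; exists d; split=> [|v].
  elim/loc_ind=> m s; rewrite /d loc_liftE // linearZ /=.
  rewrite -loc_incl_lincomb cK loc_inclE (frac_scale1 m s).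
  by congr (_ *: _); apply: eq_frac.
rewrite -[LHS]/(D _) linear_lincomb -[RHS](mulmx1) [RHS]mulmx_sum_row.
apply: eq_bigr => i _; congr (_ *: _); rewrite /= [LHS]dE.
by rewrite -(lincomb_delta e i) eK map_delta_mx row1.
Qed.

Lemma free_det_incl (M : lmodType A) (phi : {linear M -> M}) x :
  free_det (@loc_fun A S M phi) x -> free_det (@loc_fun A S' M phi) (ring_incl x).
Proof.
move=> [n [e [T [eB eT ->]]]]; exists n, (@loc_incl M \o e), (map_mx ring_incl T).
split; [exact: loc_incl_basis | move=> i | by rewrite det_map_mx].
rewrite -map_row -loc_incl_lincomb -eT /=; elim/loc_ind: (e i) => m s.
by rewrite !(loc_inclE, loc_funE).
Qed.

End LocIncl.

Lemma den_ex (A : comPzRingType) (S : mulset A) x :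
  mulset_set S x -> exists s : S, den s = x.
Proof. by move=> Sx; exists (SigSub (mem_set Sx)). Qed.

Lemma denP (A : comPzRingType) (S : mulset A) (s : S) : mulset_set S (den s).
Proof. exact: set_mem (valP s). Qed.

(** * Existence and local values of the determinant *)

Section Det.
Variable A : comPzRingType.
Implicit Types P : spec A.

(** The annihilator of [a - b] meets the complement of every prime, so it contains [1]. *)
Lemma eq_local (a b : A) :
  (forall P, loc_map (prime_compl P) a = loc_map (prime_compl P) b) -> a = b.
Proof.
move=> ab; suff [k] : ideal_set (ann 1 (a - b)) 1.
  by rewrite expr1n !mul1r => /eqP; rewrite subr_eq0 => /eqP.
apply: unit_ideal => P; have /rfracP[u] := ab P; rewrite !den1 !mul1r => uab.
by exists (den u); [exists 0%N; rewrite mul1r mulrBr uab subrr | exact: (denP u)].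
Qed.

(* A common enlargement of [powers f] and [powers g]: it plays the role of the
   overlap D(f g), but makes both restrictions inclusions of denominators. *)
Definition powers2 (f g : A) : mulset A.
Proof.
refine (@Mulset A [set s | exists m n, s = f ^+ m * g ^+ n] _ _).
- by exists 0%N, 0%N; rewrite mulr1.
- move=> _ _ [m [n ->]] [k [l ->]]; exists (m + k)%N, (n + l)%N.
  by rewrite !exprD mulrACA.
Defined.

Lemma powers_subl f g : mulset_set (powers f) `<=` mulset_set (powers2 f g).
Proof. by move=> _ [n ->]; exists n, 0%N; rewrite mulr1. Qed.

Lemma powers_subr f g : mulset_set (powers g) `<=` mulset_set (powers2 f g).
Proof. by move=> _ [n ->]; exists 0%N, n; rewrite mul1r. Qed.

Lemma powers_prime f P : ~ ideal_set P f ->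
  mulset_set (powers f) `<=` mulset_set (prime_compl P).
Proof. by move=> Pf _ [n ->]; apply: primeX. Qed.

Variables (M : lmodType A) (phi : {linear M -> M}).
Hypothesis Mlf : locally_free M.

Lemma is_detP d : is_det phi d <->
  forall f x, free_det (@loc_fun A (powers f) M phi) x -> loc_map (powers f) d = x.
Proof.
have E f n (e : 'I_n -> loc (powers f) M) (T : 'M_n) i :
    \sum_j T i j *: e j = lincomb e (row i T).
  by apply: eq_bigr => j _; rewrite mxE.
split=> [dP f _ [n [e [T [eB eT ->]]]]|dP f n e T eB eT].
  by apply: (dP _ _ e) => // i; rewrite E.
by apply: dP; exists n, e, T; split=> // i; rewrite eT E.
Qed.

Lemma free_det_local P : exists2 f, ~ ideal_set P f &
  exists x, free_det (@loc_fun A (powers f) M phi) x.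
Proof.
have [f [Pf [n [e eB]]]] := Mlf P; exists f => //.
have [T eT] := coord_mx (fun i => loc_fun phi (e i)) eB.
by exists (\det T), n, e, T.
Qed.

(** The determinants over all D(f) on which [M] is free cover Spec A and agree on overlaps by
    [free_det_uniq]. As [glue] compares its result with every member of [D], all the [f] quantified
    in [is_det] are reached. *)
Lemma is_det_ex : exists d, is_det phi d.
Proof.
(* The determinant [c / s] is rewritten [f c / (f s)]: [s] is a power of [f], possibly [f ^+ 0], and
   the extra factor makes the denominator define exactly D(f). *)
pose D p := exists f c (s : powers f),
  free_det (@loc_fun A (powers f) M phi) (rfrac c s) /\ p = (f * den s, f * c).
have [P|p q|d dP] := @glue A D.
- have [f Pf [x]] := free_det_local P; elim/loc_ring_ind: x => c s fx.
  exists (f * den s, f * c); first by exists f, c, s.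
  by apply: primeM => //; have [n ->] := denP s; apply: primeX.
- move=> [f [c [s [fc ->]]]] [g [c' [t [gc' ->]]]] /=.
  have := free_det_uniq (free_det_incl (@powers_subl f g) fc)
    (free_det_incl (@powers_subr f g) gc').
  rewrite !ring_inclE => /rfracP[u]; rewrite !den_inclE.
  have [a [b ->]] := denP u => e; exists (a + b)%N.
  pose v := f ^+ a * g ^+ b.
  transitivity (f ^+ b.+1 * g ^+ a.+1 * (den s * den t) ^+ (a + b)
     * (v * (den s * c') - v * (den t * c))).
    by rewrite /v !exprMn !exprS !exprD; ring.
  by rewrite /v e subrr mulr0.
exists d; apply/is_detP => f x; elim/loc_ring_ind: x => c s fx.
have [|m /= mE] := dP (f * den s, f * c); first by exists f, c, s.
have [n nE] := denP s.
(* This [u] is the factor left in [mE] once [f] is taken out of the difference. *)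
have [|u uE] := @den_ex A (powers f) ((f * den s) ^+ m * f).
  by exists (n.+1 * m).+1; rewrite nE -exprS -exprM -exprSr.
apply/rfracP; exists u; rewrite den1 uE; apply/eqP; rewrite -subr_eq0 -mE.
by apply/eqP; ring.
Qed.

(** By [is_det_ex] the default value of [xget] is never returned. *)
Lemma module_detP f x : free_det (@loc_fun A (powers f) M phi) x ->
  loc_map (powers f) (module_det phi) = x.
Proof. by apply/is_detP: f x; have := xgetPex 0 is_det_ex. Qed.

(** The arguments below know [module_det] only through this description at a prime, got by
    restricting from some D(f) containing [P]. *)
Lemma free_det_prime P :
  free_det (@loc_fun A (prime_compl P) M phi) (loc_map _ (module_det phi)).
Proof.
have [f Pf [x fx]] := free_det_local P.
rewrite -(ring_incl_loc_map (powers_prime Pf)) (module_detP fx).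
exact: free_det_incl.
Qed.

End Det.

(** * The two exact sequences through B/I x B/J *)

Section Pairs.
Variables (R : comPzRingType) (M N : lmodType R).

Definition inl_mod (x : M) : (M * N)%type := (x, 0).

Lemma inl_mod_is_linear : linear inl_mod.
Proof. by move=> a x y; rewrite /inl_mod; congr pair; rewrite /= scaler0 addr0. Qed.

HB.instance Definition _ := GRing.isLinear.Build R M (M * N)%type _
  inl_mod inl_mod_is_linear.

Definition pair_fun (phi : M -> M) (psi : N -> N) (x : (M * N)%type) :=
  (phi x.1, psi x.2).

Lemma pair_fun_is_linear (phi : {linear M -> M}) (psi : {linear N -> N}) :
  linear (pair_fun phi psi).
Proof. by move=> a x y; rewrite /pair_fun !linearP. Qed.

HB.instance Definition _ (phi : {linear M -> M}) (psi : {linear N -> N}) :=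
  GRing.isLinear.Build R (M * N)%type (M * N)%type _ (pair_fun phi psi)
    (pair_fun_is_linear phi psi).

End Pairs.

Section Quotients.
Variables (A : comPzRingType) (B : comPzAlgType A).
Implicit Types I J L : ideal B.

Lemma qmod_scale L a x : a *: (qcls L x : as_module (qring L)) = qcls L (alg_map a * x).
Proof. by rewrite alg_scaleE /= -rmorphM. Qed.

Lemma mu_qcls L b x : mu L b (qcls L x) = qcls L (b * x).
Proof. by rewrite /mu -rmorphM. Qed.

Variables I J : ideal B.
Let MI := as_module (qring I).
Let MJ := as_module (qring J).
Let Mcap := as_module (qring (ideal_cap I J)).
Let Madd := as_module (qring (ideal_add I J)).

(** [cap_in] and [add_out] are the diagonal and the difference map of the sequence through B/(I n J)
    and B/(I + J). Both choose representatives; [cap_inE] and [add_outE] remove the choice. *)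
Definition cap_in (u : Mcap) : (MI * MJ)%type := (qcls I (repr u), qcls J (repr u)).

Definition add_out (x : (MI * MJ)%type) : Madd := qcls _ (repr x.1 - repr x.2).

Lemma cap_inE x : cap_in (qcls _ x) = (qcls I x, qcls J x).
Proof. by have [? ?] := @repr_qcls _ (ideal_cap I J) x; congr pair; apply/qclsP. Qed.

Lemma add_outE x y : add_out (qcls I x, qcls J y) = qcls (ideal_add I J) (x - y).
Proof.
apply/qclsP; rewrite opprB addrACA [X in _ + X]addrC.
exists (repr (qcls I x) - x), (- (repr (qcls J y) - y)).
by split; [exact: repr_qcls | exact/idealN/repr_qcls | rewrite opprB /=; ring].
Qed.

Lemma cap_in_is_linear : linear cap_in.
Proof.
move=> a; elim/qring_ind=> x; elim/qring_ind=> y.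
rewrite qmod_scale -[LHS]/(cap_in (qcls _ _ + qcls _ _)) -rmorphD !cap_inE.
by rewrite !rmorphD; congr pair; congr (_ + _); apply: esym; apply: qmod_scale.
Qed.

Lemma add_out_is_linear : linear add_out.
Proof.
move=> a [u v] [u' v']; elim/qring_ind: u => x; elim/qring_ind: v => y.
elim/qring_ind: u' => x'; elim/qring_ind: v' => y'.
transitivity (add_out (qcls I (alg_map a * x + x'), qcls J (alg_map a * y + y'))).
  congr add_out; rewrite !rmorphD.
  by congr pair; congr (_ + _); apply: qmod_scale.
rewrite !add_outE qmod_scale -[RHS]/(qcls _ _ + qcls _ _) -rmorphD.
by congr qcls; ring.
Qed.

HB.instance Definition _ := GRing.isLinear.Build A Mcap (MI * MJ)%type _
  cap_in cap_in_is_linear.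
HB.instance Definition _ := GRing.isLinear.Build A (MI * MJ)%type Madd _
  add_out add_out_is_linear.

Lemma cap_in_inj : injective cap_in.
Proof.
elim/qring_ind=> x; elim/qring_ind=> y; rewrite !cap_inE => -[/qclsP Ixy /qclsP Jxy].
exact/qclsP.
Qed.

Lemma add_out_surj z : exists x, add_out x = z.
Proof.
elim/qring_ind: z => x; exists (qcls I x, qcls J 0).
by rewrite add_outE subr0.
Qed.

(** If [x - y = i + j] with [i] in [I] and [j] in [J], then [x - i = y + j] lifts both classes at
    once. *)
Lemma cap_add_exact x : add_out x = 0 <-> exists u, x = cap_in u.
Proof.
split=> [|[u ->]].
  case: x => u v; elim/qring_ind: u => x; elim/qring_ind: v => y.
  rewrite add_outE -[RHS](rmorph0 (qcls (ideal_add I J))) => /qclsP[i [j [Ii Jj]]].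
  rewrite subr0 => e; exists (qcls _ (x - i)); rewrite cap_inE.
  congr pair; apply/qclsP; first by rewrite subKr.
  have -> : y - (x - i) = - j by rewrite opprB -[y](subKr x) e; ring.
  exact: idealN.
by elim/qring_ind: u => z; rewrite cap_inE add_outE subrr; exact: rmorph0.
Qed.

Lemma det_mu_cap_add b :
  finite_locally_free MI -> finite_locally_free MJ ->
  finite_locally_free Mcap -> finite_locally_free Madd ->
  module_det (mu I b) * module_det (mu J b)
    = module_det (mu (ideal_cap I J) b) * module_det (mu (ideal_add I J) b).
Proof.
move=> [_ hI] [_ hJ] [_ hcap] [_ hadd]; apply: eq_local => P; rewrite !rmorphM /=.
apply: (@free_det_uniq _ _ (@loc_fun A (prime_compl P) _ (pair_fun (mu I b) (mu J b)))).
  apply: (free_det_loc_exact (i := @inl_mod _ MI MJ)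
      (p := (snd : {linear (MI * MJ)%type -> MJ})))
    (free_det_prime (mu I b) hI P) (free_det_prime (mu J b) hJ P).
  - by move=> x y [].
  - by move=> y; exists (0, y).
  - by move=> [x y]; split=> [/= ->|[z ->]] //; exists x.
  - by move=> x; congr pair; exact: mulr0.
  - by [].
apply: (free_det_loc_exact (i := cap_in) (p := add_out))
    (free_det_prime (mu _ b) hcap P) (free_det_prime (mu _ b) hadd P).
- exact: cap_in_inj.
- exact: add_out_surj.
- exact: cap_add_exact.
- elim/qring_ind=> x; transitivity (cap_in (qcls _ (b * x))).
    by rewrite /= !cap_inE; congr pair; apply: mu_qcls.
  by congr cap_in; apply: esym; apply: mu_qcls.
- move=> [u v]; elim/qring_ind: u => x; elim/qring_ind: v => y.
  transitivity (add_out (qcls I (b * x), qcls J (b * y))).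
    by congr add_out; congr pair; apply: mu_qcls.
  rewrite add_outE -mulrBr; transitivity (mu (ideal_add I J) b (qcls _ (x - y))).
    by apply: esym; apply: mu_qcls.
  by congr mu; apply: esym; apply: add_outE.
Qed.

End Quotients.

(** * Nonzero determinants over a field *)

(* The fields here are only known as possibly trivial rings, so a copy of the
   carrier is endowed with the library's field structure. *)
Section PzField.
Variable R : comPzRingType.
Hypotheses (R1 : 1 != 0 :> R) (RV : forall x : R, x != 0 -> exists y, y * x = 1).

Definition fieldify & (1 != 0 :> R) & (forall x : R, x != 0 -> exists y, y * x = 1)
  : Type := R.
Let F := fieldify R1 RV.

Definition pz_inv (x : F) : F :=
  xget 0 [set y : R | if x == 0 :> R then y = 0 else y * x = 1].

Lemma pz_mulVx (x : R) : x != 0 -> (pz_inv x : R) * x = 1.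
Proof.
move=> x0; have [y yx] := RV x0.
have := xgetPex 0 (P := [set y : R | if x == 0 :> R then y = 0 else y * x = 1]).
rewrite -/(pz_inv x) /= (negPf x0); apply; by exists y.
Qed.

Lemma pz_inv0 : pz_inv (0 : R) = 0 :> R.
Proof.
have := xgetPex 0 (P := [set y : R | if 0 == 0 :> R then y = 0 else y * 0 = 1]).
rewrite -/(pz_inv (0 : R)) /= eqxx; apply; by exists 0.
Qed.

HB.instance Definition _ := GRing.ComPzRing.on F.
HB.instance Definition _ := GRing.PzSemiRing_isNonZero.Build F R1.
HB.instance Definition _ := GRing.ComNzRing_isField.Build F pz_mulVx pz_inv0.

(** One direction multiplies by the adjugate; the other is [det0P], read in the field structure on
    the copy [F]. *)
Lemma pz_det0P n (T : 'M[R]_n) :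
  \det T != 0 <-> (forall v : 'rV[R]_n, v *m T = 0 -> v = 0).
Proof.
split=> [T0 v vT|T_inj].
  have /(congr1 (fun w : 'rV_n => w *m \adj T)) := vT.
  rewrite -mulmxA mul_mx_adj mul0mx mul_mx_scalar => dv.
  by have [y yd] := RV T0; rewrite -[v]scale1r -yd -scalerA dv scaler0.
apply/negP => T0; have /det0P[v /negP v0 vT] : \det (T : 'M[F]_n) == 0 by [].
by apply: v0; apply/eqP; apply: T_inj.
Qed.

End PzField.

(** * The residue field at a prime *)

Section ResidueField.
Variables (A : comPzRingType) (P : spec A).
Let S := prime_compl P.

Definition max_ideal : ideal (loc_ring S) := ideal_gen (@loc_map A S @` P).

(** The fractions with some numerator in [P] form an ideal [K] containing the generators. Primality
    of [P] carries membership from that numerator to any other numerator of the same fraction. *)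
Lemma max_idealP a (s : S) : ideal_set max_ideal (rfrac a s) <-> ideal_set P a.
Proof.
split=> [|Pa I PI]; last first.
  have -> : rfrac a s = rfrac 1 s * loc_map S a.
    by rewrite rfracM mul1r; apply: eq_rfrac; rewrite ms_mulE den1 mulr1.
  by apply: idealMl; apply: PI; exists a.
have @K : ideal (loc_ring S).
  refine (@Ideal _ [set x | exists a s, ideal_set P a /\ x = rfrac a s] _ _ _).
  - by exists 0, (ms_one S); split=> //; apply: ideal0.
  - move=> _ _ [b [t [Pb ->]]] [c [r [Pc ->]]].
    exists (den r * b + den t * c), (ms_mul t r); split; last exact: rfracD.
    by apply: idealD; apply: idealMl.
  - move=> x _ [b [t [Pb ->]]]; elim/loc_ring_ind: x => c r.
    by exists (c * b), (ms_mul r t); rewrite rfracM; split=> //; apply: idealMl.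
case/(_ K) => [_ [b Pb <-]|b [t [Pb /rfracP[u e]]]]; first by exists b, (ms_one S).
apply: contrapT => Pa.
have : ideal_set P (den u * (den t * a)) by rewrite e; do 2 apply: idealMl.
by apply: primeM (denP u) _; apply: primeM (denP t) _.
Qed.

Lemma residue_eq0 a (s : S) : qcls max_ideal (rfrac a s) = 0 <-> ideal_set P a.
Proof.
rewrite -(rmorph0 (qcls max_ideal)) -(max_idealP a s).
by split=> [/qclsP|h]; [rewrite subr0 | apply/qclsP; rewrite subr0].
Qed.

Lemma residue1 : 1 != 0 :> residue_field P.
Proof. by apply/eqP => /(residue_eq0 1 (ms_one S)); case: (spec_prime P). Qed.

Lemma residueV (x : residue_field P) : x != 0 -> exists y, y * x = 1.
Proof.
elim/qring_ind: x; elim/loc_ring_ind=> a s /eqP x0.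
have [|t tE] := @den_ex A S a; first by move=> Pa; apply: x0; apply/residue_eq0.
exists (qcls max_ideal (rfrac (den s) t)).
rewrite -rmorphM -[RHS](rmorph1 (qcls max_ideal)) rfracM; congr qcls.
by apply: eq_rfrac; rewrite !ms_mulE den1 tE; ring.
Qed.

End ResidueField.

(** * The universal property of the tensor product *)

Section TensorLift.
Variables (A : comPzRingType) (B C : comPzAlgType A) (V : zmodType).
Variable f : B -> C -> V.
Hypotheses (fDl : forall x y c, f (x + y) c = f x c + f y c)
  (fDr : forall x c d, f x (c + d) = f x c + f x d)
  (fZ : forall a x c, f (alg_map a * x) c = f x (alg_map a * c)).

Definition tensor_lift (w : tensor B C) : V := \sum_(p <- repr w) f p.1 p.2.

Lemma tensor_lift_tcls s : tensor_lift (tcls s) = \sum_(p <- s) f p.1 p.2.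
Proof. by apply: tensor_rel_lift => //; apply: repr_tcls. Qed.

Lemma tensor_lift_pure x c : tensor_lift (pure x c) = f x c.
Proof. by rewrite tensor_lift_tcls big_seq1. Qed.

Lemma tensor_liftD u v : tensor_lift (u + v) = tensor_lift u + tensor_lift v.
Proof.
elim/tcls_ind: u => s; elim/tcls_ind: v => t.
by rewrite -tclsD !tensor_lift_tcls big_cat.
Qed.

Lemma tensor_lift0 : tensor_lift 0 = 0.
Proof. by apply: (addrI (tensor_lift 0)); rewrite -tensor_liftD !addr0. Qed.

End TensorLift.

Section TensorInr.
Variables (A : comPzRingType) (B C : comPzAlgType A).

Definition tensor_inr (c : C) : tensor B C := pure 1 c.

Lemma tensor_inr_zmod : zmod_morphism tensor_inr.
Proof.
move=> x y; apply: (addIr (tensor_inr y)).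
by rewrite subrK /tensor_inr -pureDr subrK.
Qed.

Lemma tensor_inr_monoid : monoid_morphism tensor_inr.
Proof. by split=> // x y; rewrite /tensor_inr pureM mulr1. Qed.

HB.instance Definition _ :=
  GRing.isZmodMorphism.Build C (tensor B C) tensor_inr tensor_inr_zmod.
HB.instance Definition _ :=
  GRing.isMonoidMorphism.Build C (tensor B C) tensor_inr tensor_inr_monoid.

Lemma pureE x c : pure x c = tensor_inr c * tensor_inl C x.
Proof. by rewrite pureM mul1r mulr1. Qed.

End TensorInr.

(** * The fiber of B/L at a prime, in coordinates *)

Section Fiber.
Variables (A : comPzRingType) (B : comPzAlgType A) (L : ideal B) (P : spec A).
Local Notation S := (prime_compl P).
Local Notation kappa := (residue_field P).
Local Notation res := (qcls (max_ideal P)).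
Local Notation M := (as_module (qring L)).

(** A copy of the fiber quotient that carries scalars from the local ring at [P], acting through
    [kappa], so that the map from the localized module is linear. *)
Definition fiber_mod : Type := qring (fiber_ideal L P).
HB.instance Definition _ := GRing.ComPzRing.on fiber_mod.

Definition fiber_cls (w : fiber_ring B P) : fiber_mod := qcls (fiber_ideal L P) w.

HB.instance Definition _ := GRing.RMorphism.copy fiber_cls (qcls (fiber_ideal L P)).

Definition fiber_scal (c : kappa) : fiber_mod := fiber_cls (tensor_inr B c).

HB.instance Definition _ := GRing.RMorphism.copy fiber_scal
  (fiber_cls \o @tensor_inr A B kappa).

Definition fiber_scale (r : loc_ring S) (q : fiber_mod) : fiber_mod :=
  fiber_scal (res r) * q.

Lemma fiber_scaleA a b x : fiber_scale a (fiber_scale b x) = fiber_scale (a * b) x.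
Proof. by rewrite /fiber_scale !rmorphM mulrA. Qed.

Lemma fiber_scale1 : left_id 1 fiber_scale.
Proof. by move=> x; rewrite /fiber_scale !rmorph1 mul1r. Qed.

Lemma fiber_scaleDr : right_distributive fiber_scale +%R.
Proof. by move=> a x y; apply: mulrDr. Qed.

Lemma fiber_scaleDl x : {morph fiber_scale^~ x : a b / a + b}.
Proof. by move=> a b; rewrite /fiber_scale !rmorphD mulrDl. Qed.

HB.instance Definition _ := GRing.Zmodule_isLmodule.Build (loc_ring S) fiber_mod
  fiber_scaleA fiber_scale1 fiber_scaleDr fiber_scaleDl.

Definition to_fiber (u : M) : fiber_mod := fiber_cls (tensor_inl kappa (repr u)).

Lemma to_fiberE x : to_fiber (qcls L x) = fiber_cls (tensor_inl kappa x).
Proof.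
apply/qclsP; rewrite -rmorphB => K LK; apply: LK.
by exists (repr (qcls L x) - x) => //; apply: repr_qcls.
Qed.

Lemma to_fiberD : {morph to_fiber : u v / u + v}.
Proof.
elim/qring_ind=> x; elim/qring_ind=> y.
rewrite -[X in to_fiber X]/(qcls L x + qcls L y) -rmorphD !to_fiberE.
by rewrite !rmorphD.
Qed.

Lemma to_fiberZ a u : to_fiber (a *: u) = loc_map S a *: to_fiber u.
Proof.
elim/qring_ind: u => x; rewrite qmod_scale !to_fiberE.
rewrite -[RHS]/(fiber_cls (tensor_inr B (res (loc_map S a))) * _) -rmorphM.
by congr fiber_cls; rewrite -pureE /tensor_inl pureZ mulr1.
Qed.

Definition loc_to_fiber : loc S M -> fiber_mod := loc_lift to_fiber.

HB.instance Definition _ := GRing.isLinear.Build (loc_ring S) (loc S M) fiber_mod _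
  loc_to_fiber (loc_lift_is_linear to_fiberD to_fiberZ).

Variables (n : nat) (e : 'I_n -> loc S M) (c : {linear loc S M -> 'rV[loc_ring S]_n}).
Hypotheses (cK : cancel c (lincomb e)) (eK : cancel (lincomb e) c).

Definition coord_pure (x : B) (k : kappa) : 'rV[kappa]_n :=
  k *: map_mx res (c (frac (qcls L x : M) (ms_one S))).

Lemma coord_pureDl x y k : coord_pure (x + y) k = coord_pure x k + coord_pure y k.
Proof.
rewrite /coord_pure -scalerDr -map_mxD -linearD -frac_den1D.
by congr (_ *: map_mx _ (c (frac _ _))); apply: rmorphD.
Qed.

Lemma coord_pureDr x k l : coord_pure x (k + l) = coord_pure x k + coord_pure x l.
Proof. exact: scalerDl. Qed.

Lemma coord_pureZ a x k : coord_pure (alg_map a * x) k = coord_pure x (alg_map a * k).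
Proof.
rewrite /coord_pure -qmod_scale frac_den1Z linearZ map_mxZ scalerA.
by rewrite [k * _]mulrC.
Qed.

(** It is defined on the fiber ring, before dividing by [fiber_ideal L P]. That ideal is its kernel
    by [fiber_coord_eq0], and with [fiber_coord_surj] it identifies the fiber of B/L with
    [kappa]-row vectors of length [n]. *)
Definition fiber_coord : fiber_ring B P -> 'rV[kappa]_n := tensor_lift coord_pure.

Lemma fiber_coord_pure x k : fiber_coord (pure x k) = coord_pure x k.
Proof.
exact: tensor_lift_pure coord_pureDl coord_pureDr coord_pureZ x k.
Qed.

Lemma fiber_coordD u v : fiber_coord (u + v) = fiber_coord u + fiber_coord v.
Proof.
exact: tensor_liftD coord_pureDl coord_pureDr coord_pureZ u v.
Qed.

Lemma fiber_coord0 : fiber_coord 0 = 0.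
Proof. exact: tensor_lift0 coord_pureDl coord_pureDr coord_pureZ. Qed.

Lemma fiber_coordM b (T : 'M[loc_ring S]_n) w :
  (forall i, loc_fun (mu L b) (e i) = lincomb e (row i T)) ->
  fiber_coord (tensor_inl kappa b * w) = fiber_coord w *m map_mx res T.
Proof.
move=> eT; elim/tensor_ind: w => [|x k|u v hu hv].
  by rewrite mulr0 fiber_coord0 mul0mx.
  rewrite pureM mul1r !fiber_coord_pure /coord_pure -scalemxAl -map_mxM.
  congr (_ *: map_mx _ _); rewrite -[RHS]eK lincomb_mulmx -(eq_lincomb eT).
  rewrite -[lincomb _ _](linear_lincomb e (@loc_fun A S M (mu L b))) cK.
  by rewrite /= loc_funE; congr (c (frac _ _)); apply: esym; apply: mu_qcls.
by rewrite mulrDr !fiber_coordD hu hv mulmxDl.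
Qed.

Lemma fiber_coord_ideal w : ideal_set (fiber_ideal L P) w -> fiber_coord w = 0.
Proof.
(* The kernel of an additive map need not be an ideal; [K] is the largest ideal inside it, which
   suffices to contain the generators. *)
have @K : ideal (fiber_ring B P).
  refine (@Ideal _ [set w | forall u, fiber_coord (u * w) = 0] _ _ _).
  - by move=> u; rewrite mulr0 fiber_coord0.
  - by move=> v v' hv hv' u; rewrite mulrDr fiber_coordD hv hv' addr0.
  - by move=> a v hv u; rewrite mulrA.
move/(_ K) => Kw; rewrite -[w]mul1r; apply: Kw => _ [l Ll <-] u.
elim/tensor_ind: u => [|x k|u v hu hv].
- by rewrite mul0r fiber_coord0.
- rewrite pureM mulr1 fiber_coord_pure /coord_pure.
  have -> : qcls L (x * l) = 0.
    by rewrite -(rmorph0 (qcls L)); apply/qclsP; rewrite subr0; apply: idealMl.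
  by rewrite frac0 linear0 map_mx0 scaler0.
- by rewrite mulrDl fiber_coordD hu hv addr0.
Qed.

(** The class of [w] is rebuilt from its coordinates, so zero coordinates force [w] into the fiber
    ideal. *)
Lemma fiber_coordK w :
  fiber_cls w = \sum_i fiber_scal (fiber_coord w 0 i) * loc_to_fiber (e i).
Proof.
elim/tensor_ind: w => [|x k|u v hu hv].
- by rewrite fiber_coord0 rmorph0 big1 // => i _; rewrite mxE rmorph0 mul0r.
- transitivity (fiber_scal k * to_fiber (qcls L x)).
    by rewrite to_fiberE pureE; exact: rmorphM.
  have -> : to_fiber (qcls L x) = loc_to_fiber (frac (qcls L x : M) (ms_one S)).
    by rewrite /loc_to_fiber (loc_liftE to_fiberZ); exact/esym/scale1r.
  rewrite -(cK (frac _ _)) linear_lincomb mulr_sumr.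
  by apply: eq_bigr => i _; rewrite fiber_coord_pure !mxE rmorphM -mulrA.
- transitivity (fiber_cls u + fiber_cls v); first exact: rmorphD.
  rewrite fiber_coordD hu hv -big_split; apply: eq_bigr => i _.
  by rewrite mxE rmorphD mulrDl.
Qed.

Lemma fiber_coord_eq0 w : fiber_coord w = 0 <-> ideal_set (fiber_ideal L P) w.
Proof.
split=> [w0|]; last exact: fiber_coord_ideal.
rewrite -[w]subr0; apply/qclsP; rewrite rmorph0 -/(fiber_cls w) fiber_coordK w0.
by apply: big1 => i _; rewrite mxE rmorph0 mul0r.
Qed.

Lemma fiber_coord_surj v : exists w, fiber_coord w = v.
Proof.
have eE i : exists y s, e i = frac (qcls L y : M) s.
  by elim/loc_ind: (e i) => u s; elim/qring_ind: u => y; exists y, s.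
have /choice[y /choice[s ysE]] := eE.
(* As [e i] is [y i / s i], the pure tensor of [y i] and the residue of [1 / s i] has the [i]-th
   unit vector as coordinates. *)
exists (\sum_i pure (y i) (v 0 i * res (rfrac 1 (s i)))).
rewrite (big_morph _ fiber_coordD fiber_coord0) [RHS]row_sum_delta.
apply: eq_bigr => i _; rewrite fiber_coord_pure /coord_pure.
have -> : frac (qcls L (y i) : M) (ms_one S) = loc_map S (den (s i)) *: e i.
  by rewrite ysE fracZ; apply: eq_frac; rewrite ms_mulE !den1 mul1r scale1r.
rewrite linearZ map_mxZ scalerA -mulrA -rmorphM rfrac_invK rmorph1 mulr1.
by rewrite -(lincomb_delta e i) eK map_delta_mx.
Qed.

Lemma regular_fiber b (T : 'M[loc_ring S]_n) :
  (forall i, loc_fun (mu L b) (e i) = lincomb e (row i T)) ->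
  regular_locus L b P <->
  (forall v : 'rV[kappa]_n, v *m map_mx res T = 0 -> v = 0).
Proof.
move=> eT; split=> [b_inj v|T_inj].
  have [w <-] := fiber_coord_surj v; rewrite -(fiber_coordM _ eT) !fiber_coord_eq0.
  move=> bw; rewrite -[w]subr0; apply/qclsP; apply: b_inj.
  by rewrite /= -!rmorphM mulr0; apply/qclsP; rewrite subr0.
elim/qring_ind=> u; elim/qring_ind=> v; rewrite /= -!rmorphM => /qclsP.
rewrite -mulrBr => /fiber_coord_eq0; rewrite (fiber_coordM _ eT).
by move=> /T_inj/fiber_coord_eq0 uv; apply/qclsP.
Qed.

End Fiber.

(** * The loci as nonvanishing sets of determinants *)

Lemma regular_locusP (A : comPzRingType) (B : comPzAlgType A) (L : ideal B) b P :
  finite_locally_free (as_module (qring L)) ->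
  regular_locus L b P <-> ~ ideal_set P (module_det (mu L b)).
Proof.
move=> [_ hL]; have [n [e [T [eB eT dT]]]] := free_det_prime (mu L b) hL P.
have [c [cK eK]] := linear_coord eB.
rewrite (regular_fiber cK eK eT) -(pz_det0P (@residue1 A P) (@residueV A P)).
(* The determinant of the reduced matrix is the residue class of [module_det (mu L b)], which
   vanishes exactly when that element lies in [P]. *)
rewrite det_map_mx -dT /= -(residue_eq0 _ (ms_one _)).
by split=> [/eqP|] // /eqP.
Qed.

Theorem theorem4p3 (A : comPzRingType) (B : comPzAlgType A) (I J : ideal B)
  (hI : finite_locally_free (as_module (qring I)))
  (hJ : finite_locally_free (as_module (qring J)))
  (hIJcap : finite_locally_free (as_module (qring (ideal_cap I J))))
  (hIJadd : finite_locally_free (as_module (qring (ideal_add I J))))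
  (b : B) :
  module_det (mu I b) * module_det (mu J b)
    = module_det (mu (ideal_cap I J) b) * module_det (mu (ideal_add I J) b)
  /\
  regular_locus I b `&` regular_locus J b
    = regular_locus (ideal_cap I J) b `&` regular_locus (ideal_add I J) b.
Proof.
have E := det_mu_cap_add b hI hJ hIJcap hIJadd; split=> //.
have U (K L : ideal B) P : finite_locally_free (as_module (qring K)) ->
    finite_locally_free (as_module (qring L)) ->
    (regular_locus K b `&` regular_locus L b) P <->
    ~ ideal_set P (module_det (mu K b) * module_det (mu L b)).
  move=> hK hL; rewrite /setI /= !regular_locusP //; split=> [[]|KL].
    exact: primeM.
  by split=> h; apply: KL; [rewrite mulrC|]; apply: idealMl.
apply/seteqP; split=> P.
  by move/(U I J P hI hJ); rewrite E => h; apply/U.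
by move/(U _ _ P hIJcap hIJadd); rewrite -E => h; apply/U.
Qed.
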